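(* The problem \textsc{Prescribed NS-Foremost-path TGR} can be solved in $\mathcal{O}(n^2 m)$ time and $\mathcal{O}(n^2)$ space, where $m$ is the number of edges of the prescribed graph. Furthermore, if the instance is realizable, a realization with at most $n^2$ time labels in total can be computed within the same time and space bounds.
   Context: A temporal graph $\mathcal{G}=(G,\lambda)$ consists of a static undirected graph $G=(V,E)$ (its underlying graph) with $V=[n]$ and a labeling $\lambda:E\to 2^{\mathbb{N}_{>0}}$ assigning to each edge the (finite) set of positive times at which it appears; the number of time labels is $\sum_e|\lambda(e)|$. A non-strict temporal $uv$-path is a path $u=v_0,\dots,v_k=v$ in $G$ with distinct vertices and times $\tau_1\le\dots\le\tau_k$, $\tau_i\in\lambda(\{v_{i-1},v_i\})$; its arrival time is $\tau_k$. $\mathrm{NS}\text{-}\mathrm{Fo}(\mathcal{G})$ is the $n\times n$ matrix with diagonal $0$ and entry $(u,v)$, $u\ne v$, the minimum arrival time of a non-strict temporal $uv$-path ($\infty$ if none). A distance matrix is an $n\times n$ matrix with entries in $\mathbb{N}\cup\{\infty\}$, zero exactly on the diagonal. \textsc{Prescribed NS-Foremost-path TGR}: given $n$, an $n\times n$ distance matrix $D$ and a static graph $G_p=([n],E_p)$ (the prescribed graph), decide whether there exists a temporal graph $\mathcal{G}=(G,\lambda)$ on $[n]$ with $\mathrm{NS}\text{-}\mathrm{Fo}(\mathcal{G})=D$ and $G$ a subgraph of $G_p$. *)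

(* Defs.v *)
From mathcomp Require Import all_boot all_order all_algebra.
From mathcomp Require Import finmap boolp.

Set Implicit Arguments.
Unset Strict Implicit.
Unset Printing Implicit Defensive.

(** ** Temporal graphs on the vertex set 'I_n *)

Record static_graph (n : nat) := StaticGraph {
  edges : {set {set 'I_n}};
  edges_card2 : forall e, e \in edges -> #|e| = 2
}.

Definition subgraph n (G H : static_graph n) : Prop := edges G \subset edges H.

(* [label] is a total function; its values outside the edge set are never
   used. An edge may have an empty set of labels. *)
Record temporal_graph (n : nat) := TemporalGraph {
  underlying :> static_graph n;
  label : {set 'I_n} -> {fset nat};
  label_gt0 : forall e t, e \in edges underlying -> t \in label e -> 0 < t
}.

Definition labels n (G : temporal_graph n) : seq ({set 'I_n} * nat) :=
  [seq (e, t) | e <- enum (edges G), t <- enum_fset (label G e)].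

Definition num_labels n (G : temporal_graph n) : nat :=
  (\sum_(e in edges G) #|` label G e|)%N.

(* A path u = v_0, ..., v_k with times tau_1, ..., tau_k is represented by u
   and the sequence (v_1, tau_1), ..., (v_k, tau_k). *)
Definition ns_hop n (G : temporal_graph n) : rel ('I_n * nat) :=
  fun x y => [&& [set x.1; y.1] \in edges G,
                 y.2 \in label G [set x.1; y.1] & x.2 <= y.2].

(* The initial time 0 imposes no condition on tau_1. *)
Definition ns_temporal_path n (G : temporal_graph n) (u v : 'I_n)
    (p : seq ('I_n * nat)) : bool :=
  [&& path (ns_hop G) (u, 0) p, uniq (u :: unzip1 p)
    & last u (unzip1 p) == v].

Definition arrival (p : seq nat) : nat := last 0 p.

Definition ns_arrives n (G : temporal_graph n) (u v : 'I_n) (a : nat) : Prop :=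
  exists2 p, ns_temporal_path G u v p & arrival (unzip2 p) = a.

(** ** Distance matrices; None stands for infinity *)

Definition min_or_infty (P : nat -> Prop) : option nat :=
  match pselect (exists a, `[< P a >]) with
  | left exP => Some (ex_minn exP)
  | right _ => None
  end.

Definition NS_Fo n (G : temporal_graph n) : 'M[option nat]_n :=
  \matrix_(u, v) if u == v then Some 0 else min_or_infty (ns_arrives G u v).

Definition distance_matrix n (D : 'M[option nat]_n) : Prop :=
  forall u v, D u v = Some 0 <-> u = v.

Definition max_entry n (D : 'M[option nat]_n) : nat :=
  (\max_u \max_v odflt 0 (D u v))%N.

Definition realizes n (D : 'M[option nat]_n) (Gp : static_graph n)
    (G : temporal_graph n) : Prop :=
  NS_Fo G = D /\ subgraph G Gp.

Definition prescribed_NSFo_TGR n (D : 'M[option nat]_n)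
    (Gp : static_graph n) : Prop :=
  exists G, realizes D Gp G.

(** ** Word RAM *)

(* A program is a structured command over finitely many registers and a memory
   with indirect addressing. The machine has [space] memory cells, and every
   constant and every result of an operation must be smaller than [wbound].
   An out-of-range address or an overflow is an error: no execution exists. *)

Inductive binop := Add | Sub | Mul | Eq | Lt.

Inductive expr :=
  | Const of nat
  | Reg of nat
  | Cell of expr
  | Bin of binop & expr & expr.

Inductive cmd :=
  | Skip
  | Assign of nat & expr
  | Store of expr & expr
  | Seq of cmd & cmd
  | If of expr & cmd & cmd
  | While of expr & cmd.

Record state := State { reg : nat -> nat; mem : nat -> nat }.

Definition update (f : nat -> nat) (i v : nat) : nat -> nat :=
  fun j => if j == i then v else f j.

(* Subtraction is truncated; comparisons return 0 or 1. *)
Definition binop_sem (o : binop) (a b : nat) : nat :=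
  match o with
  | Add => a + b
  | Sub => a - b
  | Mul => a * b
  | Eq => a == b
  | Lt => a < b
  end.

Section Semantics.
Variables space wbound : nat.

Definition fit (v : nat) : option nat := if v < wbound then Some v else None.

Fixpoint eval (s : state) (e : expr) : option nat :=
  match e with
  | Const k => fit k
  | Reg x => Some (reg s x)
  | Cell e => obind (fun a => if a < space then Some (mem s a) else None)
                    (eval s e)
  | Bin o e1 e2 =>
      obind (fun a => obind (fun b => fit (binop_sem o a b)) (eval s e2))
            (eval s e1)
  end.

Fixpoint expr_cost (e : expr) : nat :=
  match e with
  | Const _ | Reg _ => 1
  | Cell e => (expr_cost e).+1
  | Bin _ e1 e2 => (expr_cost e1 + expr_cost e2).+1
  end.

(* [exec c s t s']: from state s, command c halts in state s' after t
   elementary steps. The relation is deterministic. *)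
Inductive exec : cmd -> state -> nat -> state -> Prop :=
  | exec_Skip s : exec Skip s 1 s
  | exec_Assign s x e v :
      eval s e = Some v ->
      exec (Assign x e) s (expr_cost e).+1 (State (update (reg s) x v) (mem s))
  | exec_Store s e1 e2 a v :
      eval s e1 = Some a -> eval s e2 = Some v -> a < space ->
      exec (Store e1 e2) s (expr_cost e1 + expr_cost e2).+1
           (State (reg s) (update (mem s) a v))
  | exec_Seq s1 s2 s3 c1 c2 t1 t2 :
      exec c1 s1 t1 s2 -> exec c2 s2 t2 s3 ->
      exec (Seq c1 c2) s1 (t1 + t2) s3
  | exec_If s s' e c1 c2 v t :
      eval s e = Some v -> exec (if v != 0 then c1 else c2) s t s' ->
      exec (If e c1 c2) s (expr_cost e + t).+1 s'
  | exec_While_stop s e c :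
      eval s e = Some 0 -> exec (While e c) s (expr_cost e).+1 s
  | exec_While_loop s1 s2 s3 e c v t1 t2 :
      eval s1 e = Some v -> v != 0 ->
      exec c s1 t1 s2 -> exec (While e c) s2 t2 s3 ->
      exec (While e c) s1 (expr_cost e + t1 + t2).+1 s3.

End Semantics.

(** ** Input and output conventions *)

(* Register 0 contains n. The memory contains D in row-major order (infinity as
   0, a finite entry d as d + 1), then the adjacency matrix of Gp in row-major
   order. All other registers and cells are 0. *)
Definition encode_entry (d : option nat) : nat :=
  if d is Some k then k.+1 else 0.

Definition encode_input n (D : 'M[option nat]_n) (Gp : static_graph n) :
    seq nat :=
  [seq encode_entry (D u v) | u <- enum 'I_n, v <- enum 'I_n] ++
  [seq ([set u; v] \in edges Gp : nat) | u <- enum 'I_n, v <- enum 'I_n].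

Definition initial_state n (D : 'M[option nat]_n) (Gp : static_graph n) :
    state :=
  State (update (fun _ => 0) 0 n) (nth 0 (encode_input D Gp)).

Definition accepts (s : state) : Prop := reg s 0 != 0.

(* Register 1 contains a number k and register 2 an address from which k
   triples of cells (u, v, t) list the pairs ({u, v}, t) with t a label of the
   edge {u, v}, each of them exactly once. *)
Definition outputs space (s : state) n (G : temporal_graph n) : Prop :=
  (forall e, e \in edges G -> label G e != fset0) /\
  reg s 2 + 3 * reg s 1 <= space /\
  exists l : seq ('I_n * 'I_n * nat),
    mkseq (fun i => mem s (reg s 2 + i)) (3 * reg s 1)
      = flatten [seq [:: val x.1.1; val x.1.2; x.2] | x <- l] /\
    perm_eq [seq ([set x.1.1; x.1.2], x.2) | x <- l] (labels G).

(** ** Resource bounds *)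

(* The parameters are replaced by their maximum with 1, since already reading
   the input takes n^2 steps when m = 0. *)
Definition time_bound (c n m : nat) : nat := c * (maxn 1 n ^ 2 * maxn 1 m).

Definition space_bound (c n : nat) : nat := c * maxn 1 n ^ 2.

(* Words of O(log (n + max D)) bits. *)
Definition word_bound (c n : nat) (D : 'M[option nat]_n) : nat :=
  (n + max_entry D + 2) ^ c.

Definition runs_within (prog : cmd) (c : nat) n (D : 'M[option nat]_n)
    (Gp : static_graph n) (post : state -> Prop) : Prop :=
  exists t s, [/\ exec (space_bound c n) (word_bound c D) prog
                       (initial_state D Gp) t s,
                  t <= time_bound c n #|edges Gp|
                & post s].

(* Main.v *)
Require Import Defs.
From mathcomp Require Import all_boot all_order all_algebra.
From mathcomp Require Import finmap boolp zify.

(** A label t may be put on an edge {x, y} of a realization of D only if it is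
safe: no vertex w has exactly one of D w x and D w y at most t. Conversely, safe
labels never make any vertex reachable too early. Hence D is realizable if and
only if the safe labels reach every v from every u at time D u v. Such an
arrival exists if and only if v is reachable from u along the arcs (x, y) for
which D u y is a safe label of {x, y}: if t = D u v is minimal such that v is not
reachable, then the first unreachable vertex y of a foremost path to v is entered
at time t = D u y by a safe label. For each u this is a Bellman-Ford search over
at most 2m arcs, and n - 1 labels suffice for u, namely those of the search
tree. *)

Set Implicit Arguments.
Unset Strict Implicit.
Unset Printing Implicit Defensive.

(** * An array language on top of the word RAM *)

(* Matrices [EMat i] have n rows and n columns and vectors [EVec i] have length
   3 * n ^ 2; [AFor i b c] runs [c] with register [i] going from 0 up to the
   value of register [b]. *)
Inductive aexpr :=
  | ENat of nat
  | EReg of nat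
  | EVec of nat & aexpr
  | EMat of nat & aexpr & aexpr
  | EBin of binop & aexpr & aexpr.

Inductive acmd :=
  | ASet of nat & aexpr
  | AVec of nat & aexpr & aexpr
  | AMat of nat & aexpr & aexpr & aexpr
  | ASeq of acmd & acmd
  | AIf of aexpr & acmd
  | AFor of nat & nat & acmd.

(* Registers 0 and 4 hold n and n ^ 2. The input occupies matrices 0 and 1;
   matrix 2 comes next, and the vectors follow. *)
Definition mat_addr (i : nat) (x y : expr) : expr :=
  Bin Add (Bin Mul (Const i) (Reg 4)) (Bin Add (Bin Mul x (Reg 0)) y).

Definition vec_addr (i : nat) (k : expr) : expr :=
  Bin Add (Bin Mul (Const (3 + 3 * i)) (Reg 4)) k.

Fixpoint cexpr (e : aexpr) : expr :=
  match e with
  | ENat k => Const k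
  | EReg x => Reg x
  | EVec i k => Cell (vec_addr i (cexpr k))
  | EMat i x y => Cell (mat_addr i (cexpr x) (cexpr y))
  | EBin o e1 e2 => Bin o (cexpr e1) (cexpr e2)
  end.

Fixpoint compile (c : acmd) : cmd :=
  match c with
  | ASet x e => Assign x (cexpr e)
  | AVec i k e => Store (vec_addr i (cexpr k)) (cexpr e)
  | AMat i x y e => Store (mat_addr i (cexpr x) (cexpr y)) (cexpr e)
  | ASeq c1 c2 => Seq (compile c1) (compile c2)
  | AIf e c => If (cexpr e) (compile c) Skip
  | AFor i b c =>
      Seq (Assign i (Const 0))
          (While (Bin Lt (Reg i) (Reg b))
             (Seq (compile c) (Assign i (Bin Add (Reg i) (Const 1)))))
  end.

Fixpoint mod_regs (c : acmd) : seq nat :=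
  match c with
  | ASet x _ => [:: x]
  | ASeq c1 c2 => mod_regs c1 ++ mod_regs c2
  | AIf _ c => mod_regs c
  | AFor i _ c => i :: mod_regs c
  | _ => [::]
  end.

Fixpoint mod_vecs (c : acmd) : seq nat :=
  match c with
  | AVec i _ _ => [:: i]
  | ASeq c1 c2 => mod_vecs c1 ++ mod_vecs c2
  | AIf _ c | AFor _ _ c => mod_vecs c
  | _ => [::]
  end.

Fixpoint mod_mats (c : acmd) : seq nat :=
  match c with
  | AMat i _ _ _ => [:: i]
  | ASeq c1 c2 => mod_mats c1 ++ mod_mats c2
  | AIf _ c | AFor _ _ c => mod_mats c
  | _ => [::]
  end.

Record astate := AState {
  rg : nat -> nat;
  vc : nat -> nat -> nat;
  mt : nat -> nat -> nat -> nat
}.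

Definition set_rg (s : astate) (x v : nat) : astate :=
  AState (update (rg s) x v) (vc s) (mt s).

Definition set_vc (s : astate) (i k v : nat) : astate :=
  AState (rg s)
    (fun i' k' => if (i' == i) && (k' == k) then v else vc s i' k') (mt s).

Definition set_mt (s : astate) (i x y v : nat) : astate :=
  AState (rg s) (vc s)
    (fun i' x' y' => if [&& i' == i, x' == x & y' == y] then v else mt s i' x' y').

Definition framed (rs vs ms : seq nat) (s s' : astate) : Prop :=
  [/\ forall x, x \notin rs -> rg s' x = rg s x,
      forall i, i \notin vs -> vc s' i = vc s i
    & forall i, i \notin ms -> mt s' i = mt s i].

Lemma framed_trans rs vs ms s2 s1 s3 :
  framed rs vs ms s1 s2 -> framed rs vs ms s2 s3 -> framed rs vs ms s1 s3.
Proof.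
move=> [r1 v1 m1] [r2 v2 m2]; split=> x hx.
- by rewrite r2 // r1.
- by rewrite v2 // v1.
- by rewrite m2 // m1.
Qed.

Lemma framed_sub rs vs ms rs' vs' ms' s s' :
  {subset rs <= rs'} -> {subset vs <= vs'} -> {subset ms <= ms'} ->
  framed rs vs ms s s' -> framed rs' vs' ms' s s'.
Proof.
move=> hr hv hm [r v m]; split=> x hx.
- by apply: r; apply: contra hx; apply: hr.
- by apply: v; apply: contra hx; apply: hv.
- by apply: m; apply: contra hx; apply: hm.
Qed.

Lemma framed_set_rg rs vs ms s x v :
  x \in rs -> framed rs vs ms s (set_rg s x v).
Proof.
move=> hx; split=> // y hy; rewrite /= /update; case: eqP => // yx.
by rewrite yx hx in hy.
Qed.

Fixpoint aeval (s : astate) (e : aexpr) : nat :=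
  match e with
  | ENat k => k
  | EReg x => rg s x
  | EVec i k => vc s i (aeval s k)
  | EMat i x y => mt s i (aeval s x) (aeval s y)
  | EBin o e1 e2 => binop_sem o (aeval s e1) (aeval s e2)
  end.

Section ArrayLanguage.
Variables n K space wbound : nat.
Hypothesis space_big : 15 * (n * n) <= space.
Hypothesis wbound_big : 15 * (n * n) + K + n + 16 < wbound.

Fixpoint defined (s : astate) (e : aexpr) : Prop :=
  match e with
  | ENat k => k < wbound
  | EReg _ => True
  | EVec i k => [/\ i < 4, defined s k & aeval s k < 3 * (n * n)]
  | EMat i x y =>
      [/\ i < 3, defined s x /\ aeval s x < n & defined s y /\ aeval s y < n]
  | EBin o e1 e2 =>
      [/\ defined s e1, defined s e2 & aeval s (EBin o e1 e2) < wbound]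
  end.

(* [K] bounds every loop that does not run up to register 0. *)
Definition loop_bound (b : nat) : nat := if b == 0 then n else K.

Fixpoint acost (c : acmd) : nat :=
  match c with
  | ASet _ e => (expr_cost (cexpr e)).+1
  | AVec i k e => (expr_cost (vec_addr i (cexpr k)) + expr_cost (cexpr e)).+1
  | AMat i x y e =>
      (expr_cost (mat_addr i (cexpr x) (cexpr y)) + expr_cost (cexpr e)).+1
  | ASeq c1 c2 => acost c1 + acost c2
  | AIf e c => (expr_cost (cexpr e) + (acost c).+1).+1
  | AFor _ b c => 6 + loop_bound b * (acost c + 8)
  end.

Definition represents (m : state) (s : astate) : Prop :=
  [/\ reg m = rg s, rg s 0 = n, rg s 4 = n * n,
      forall i x y, i < 3 -> x < n -> y < n ->
        Defs.mem m (i * (n * n) + (x * n + y)) = mt s i x y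
    & forall i k, i < 4 -> k < 3 * (n * n) ->
        Defs.mem m ((3 + 3 * i) * (n * n) + k) = vc s i k].

Lemma index_bound x y : x < n -> y < n -> x * n + y < n * n.
Proof.
move=> hx hy; apply: (@leq_trans (x.+1 * n)); first by rewrite mulSn addnC ltn_add2r.
by rewrite leq_mul2r hx orbT.
Qed.

Lemma index_inj x y x' y' : y < n -> y' < n ->
  (x * n + y == x' * n + y') = (x == x') && (y == y').
Proof.
move=> hy hy'; apply/eqP/andP => [e|[/eqP -> /eqP ->] //].
have n0 : 0 < n by lia.
have := congr1 (divn^~ n) e; rewrite /= !divnMDl // !divn_small // !addn0 => ->.
have := congr1 (modn^~ n) e; rewrite /= !modnMDl !modn_small // => ->.
by rewrite !eqxx.
Qed.

Lemma eval_mat_addr m s i x y vx vy : represents m s ->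
  i < 3 -> vx < n -> vy < n ->
  eval space wbound m x = Some vx -> eval space wbound m y = Some vy ->
  eval space wbound m (mat_addr i x y) = Some (i * (n * n) + (vx * n + vy)) /\
  i * (n * n) + (vx * n + vy) < space.
Proof.
move=> [hr h0 h4 _ _] hi hx hy ex ey; have := index_bound hx hy => hxy.
rewrite /= hr h0 h4 ex ey /= /fit.
have -> : i < wbound by lia.
have hiN : i * (n * n) <= 2 * (n * n) by rewrite leq_mul2r -ltnS hi orbT.
rewrite /=; have -> : i * (n * n) < wbound by lia.
have -> : vx * n < wbound by lia.
by rewrite /= ifT /=; [rewrite ifT; [split=> //; lia|lia]|lia].
Qed.

Lemma eval_vec_addr m s i k vk : represents m s ->
  i < 4 -> vk < 3 * (n * n) -> eval space wbound m k = Some vk ->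
  eval space wbound m (vec_addr i k) = Some ((3 + 3 * i) * (n * n) + vk) /\
  (3 + 3 * i) * (n * n) + vk < space.
Proof.
move=> [hr h0 h4 _ _] hi hk ek.
rewrite /= hr h4 ek /= /fit.
have -> : 3 + 3 * i < wbound by lia.
have hiN : (3 + 3 * i) * (n * n) <= 12 * (n * n) by rewrite leq_mul2r; lia.
rewrite /= ifT /=; last by lia.
by rewrite ifT; [split=> //; lia|lia].
Qed.

Lemma eval_Cell m e a : eval space wbound m e = Some a ->
  eval space wbound m (Cell e) = if a < space then Some (Defs.mem m a) else None.
Proof. by move=> /= ->. Qed.

Lemma eval_cexpr m s e : represents m s -> defined s e ->
  eval space wbound m (cexpr e) = Some (aeval s e).
Proof.
move=> hms; have [hr h0 h4 hm hv] := hms.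
elim: e => [k|x|i k IHk|i x IHx y IHy|o e1 IH1 e2 IH2]; rewrite [defined _ _]/=.
- by move=> hk; rewrite /= /fit hk.
- by rewrite /= hr.
- move=> [hi /IHk ek hk].
  have [ea ha] := eval_vec_addr hms hi hk ek.
  by rewrite [cexpr _]/= (eval_Cell ea) ha hv.
- move=> [hi [/IHx ex hx] [/IHy ey hy]].
  have [ea ha] := eval_mat_addr hms hi hx hy ex ey.
  by rewrite [cexpr _]/= (eval_Cell ea) ha hm.
- by move=> [/IH1 e1E /IH2 e2E hb]; rewrite /= e1E e2E /= /fit hb.
Qed.

Lemma represents_set_rg m s (x v : nat) : x != 0 -> x != 4 -> represents m s ->
  represents (State (update (reg m) x v) (Defs.mem m)) (set_rg s x v).
Proof.
move=> x0 x4 [hr h0 h4 hm hv]; split=> //=; first by rewrite hr.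
- by rewrite /update eq_sym (negPf x0).
- by rewrite /update eq_sym (negPf x4).
Qed.

Lemma represents_set_mt m s i x y v : i < 3 -> x < n -> y < n ->
  represents m s ->
  represents (State (reg m) (update (Defs.mem m) (i * (n * n) + (x * n + y)) v))
             (set_mt s i x y v).
Proof.
move=> hi hx hy [hr h0 h4 hm hv]; have hxy := index_bound hx hy.
split=> //=.
- move=> i' x' y' hi' hx' hy'; have hxy' := index_bound hx' hy'.
  rewrite /update -hm // -(index_inj x' x hy' hy).
  congr (if _ then _ else _).
  by case: i hi => [|[|[|//]]] _; case: i' hi' => [|[|[|//]]] _ //=; lia.
- move=> i' k hi' hk; rewrite /update -hv //.
  case: eqP => // e.
  by case: i hi e => [|[|[|//]]] _; case: i' hi' => [|[|[|[|//]]]] _ //=; lia.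
Qed.

Lemma represents_set_vc m s i k v : i < 4 -> k < 3 * (n * n) ->
  represents m s ->
  represents (State (reg m) (update (Defs.mem m) ((3 + 3 * i) * (n * n) + k) v))
             (set_vc s i k v).
Proof.
move=> hi hk [hr h0 h4 hm hv]; split=> //=.
- move=> i' x' y' hi' hx' hy'; have hxy' := index_bound hx' hy'.
  rewrite /update -hm //; case: eqP => // e.
  by case: i hi e => [|[|[|[|//]]]] _; case: i' hi' => [|[|[|//]]] _ //=; lia.
- move=> i' k' hi' hk'; rewrite /update -hv //.
  congr (if _ then _ else _).
  by case: i hi => [|[|[|[|//]]]] _; case: i' hi' => [|[|[|[|//]]]] _ //=; lia.
Qed.

Definition arun (c : acmd) (s : astate) (Q : astate -> Prop) : Prop :=
  forall m, represents m s -> exists t m' s',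
    [/\ exec space wbound (compile c) m t m', t <= acost c, represents m' s',
        framed (mod_regs c) (mod_vecs c) (mod_mats c) s s' & Q s'].

Lemma arun_weaken c s (Q Q' : astate -> Prop) :
  arun c s Q' ->
  (forall s', framed (mod_regs c) (mod_vecs c) (mod_mats c) s s' ->
     Q' s' -> Q s') ->
  arun c s Q.
Proof.
move=> h hQ m /h [t [m' [s' [h1 h2 h3 h4 h5]]]].
by exists t, m', s'; split=> //; apply: hQ.
Qed.

Lemma arun_set (x : nat) e s (Q : astate -> Prop) :
  x != 0 -> x != 4 -> defined s e ->
  Q (set_rg s x (aeval s e)) -> arun (ASet x e) s Q.
Proof.
move=> x0 x4 he hQ m hm.
exists (expr_cost (cexpr e)).+1, (State (update (reg m) x (aeval s e)) (Defs.mem m)).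
exists (set_rg s x (aeval s e)); split=> //.
- by apply/exec_Assign/eval_cexpr.
- exact: represents_set_rg.
- by apply: framed_set_rg; rewrite /= inE.
Qed.

Lemma arun_vec i k e s (Q : astate -> Prop) :
  defined s (EVec i k) -> defined s e ->
  Q (set_vc s i (aeval s k) (aeval s e)) -> arun (AVec i k e) s Q.
Proof.
move=> [hi hk hk3] he hQ m hm.
have [ea ha] := eval_vec_addr hm hi hk3 (eval_cexpr hm hk).
do 3 eexists; split; [exact: exec_Store ea (eval_cexpr hm he) ha|by []| | |exact: hQ].
- exact: represents_set_vc.
- split=> //= j; rewrite inE => /negPf ji.
  by apply/funext => k'; rewrite ji.
Qed.

Lemma arun_mat i x y e s (Q : astate -> Prop) :
  defined s (EMat i x y) -> defined s e ->
  Q (set_mt s i (aeval s x) (aeval s y) (aeval s e)) -> arun (AMat i x y e) s Q.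
Proof.
move=> [hi [dx hx] [dy hy]] he hQ m hm.
have [ea ha] := eval_mat_addr hm hi hx hy (eval_cexpr hm dx) (eval_cexpr hm dy).
do 3 eexists; split; [exact: exec_Store ea (eval_cexpr hm he) ha|by []| | |exact: hQ].
- exact: represents_set_mt.
- split=> //= j; rewrite inE => /negPf ji.
  by apply/funext => x'; apply/funext => y'; rewrite ji.
Qed.

Lemma arun_seq c1 c2 s (Q : astate -> Prop) :
  arun c1 s (fun s1 => arun c2 s1 Q) -> arun (ASeq c1 c2) s Q.
Proof.
move=> h m /h [t1 [m1 [s1 [e1 T1 r1 f1 h1]]]].
have [t2 [m2 [s2 [e2 T2 r2 f2 h2]]]] := h1 _ r1.
exists (t1 + t2), m2, s2; split=> //=.
- exact: exec_Seq e1 e2.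
- exact: leq_add.
- apply: (@framed_trans _ _ _ s1).
  + by apply: framed_sub f1 => x hx; rewrite mem_cat hx.
  + by apply: framed_sub f2 => x hx; rewrite mem_cat hx orbT.
Qed.

Lemma arun_if e c s (Q : astate -> Prop) :
  defined s e -> (aeval s e != 0 -> arun c s Q) -> (aeval s e = 0 -> Q s) ->
  arun (AIf e c) s Q.
Proof.
move=> he h1 h0 m hm; have ev := eval_cexpr hm he.
case: (eqVneq (aeval s e) 0) => [e0|e1].
- exists (expr_cost (cexpr e) + 1).+1, m, s; split=> //=; last exact: h0.
  + by apply: (exec_If ev); rewrite e0; apply: exec_Skip.
  + by lia.
- have [t [m' [s' [h T r f q]]]] := h1 e1 _ hm.
  exists (expr_cost (cexpr e) + t).+1, m', s'; split=> //=; last by lia.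
  by apply: (exec_If ev); rewrite e1.
Qed.

Lemma arun_for (I : nat -> astate -> Prop) (i b : nat) c s (Q : astate -> Prop) :
  i \notin [:: 0, 4, b & mod_regs c] -> b \notin mod_regs c ->
  rg s b <= loop_bound b ->
  I 0 (set_rg s i 0) ->
  (forall k s', k < rg s b -> rg s' i = k ->
     framed (i :: mod_regs c) (mod_vecs c) (mod_mats c) s s' -> I k s' ->
     arun c s' (fun s'' => I k.+1 (set_rg s'' i k.+1))) ->
  (forall s', framed (i :: mod_regs c) (mod_vecs c) (mod_mats c) s s' ->
     I (rg s b) s' -> Q s') ->
  arun (AFor i b c) s Q.
Proof.
rewrite !inE !negb_or => /and4P [i0 i4 ib ic] bc hb I0 hI hQ m hm.
have lbW : loop_bound b + 1 < wbound by rewrite /loop_bound; case: ifP; lia.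
have ib' : b == i = false by rewrite eq_sym (negPf ib).
pose loop := While (Bin Lt (Reg i) (Reg b))
               (Seq (compile c) (Assign i (Bin Add (Reg i) (Const 1)))).
have loopP : forall j k m0 s0, k + j = rg s b -> represents m0 s0 ->
    rg s0 i = k ->
    framed (i :: mod_regs c) (mod_vecs c) (mod_mats c) s s0 -> I k s0 ->
    exists t m' s', [/\ exec space wbound loop m0 t m',
      t <= 4 + j * (acost c + 8), represents m' s',
      framed (i :: mod_regs c) (mod_vecs c) (mod_mats c) s s' & I (rg s b) s'].
  elim=> [|j IHj] k m0 s0 hk hm0 hi hf hIk.
  - have hb0 : rg s0 b = rg s b.
      by case: hf => /(_ b) -> //; rewrite inE ib' .
    have [hr0 _ _ _ _] := hm0.
    exists 4, m0, s0; split=> //; last by rewrite -hk addn0.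
    apply: exec_While_stop.
    by rewrite /= hr0 hi hb0 -hk addn0 /= ltnn /fit; have -> : 0 < wbound by lia.
  - have hb0 : rg s0 b = rg s b.
      by case: hf => /(_ b) -> //; rewrite inE ib'.
    have [hr0 _ _ _ _] := hm0.
    have kb : k < rg s b by lia.
    have [t1 [m1 [s1 [e1 T1 r1 f1 h1]]]] := hI _ _ kb hi hf hIk _ hm0.
    have hi1 : rg s1 i = k by case: f1 => -> //.
    have [hr1 _ _ _ _] := r1.
    have r2 := represents_set_rg k.+1 i0 i4 r1.
    have hi2 : rg (set_rg s1 i k.+1) i = k.+1 by rewrite /= /update eqxx.
    have f2 : framed (i :: mod_regs c) (mod_vecs c) (mod_mats c) s (set_rg s1 i k.+1).
      apply: framed_trans hf _; apply: (@framed_trans _ _ _ s1).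
      + by apply: framed_sub f1 => x // hx; rewrite inE hx orbT.
      + by apply: framed_set_rg; rewrite inE eqxx.
    have kj : k.+1 + j = rg s b by lia.
    have [t2 [m2 [s2 [e2 T2 r2' f2' h2]]]] := IHj _ _ _ kj r2 hi2 f2 h1.
    exists (3 + (t1 + 4) + t2).+1, m2, s2; split=> //; last by lia.
    apply: (exec_While_loop (v := 1)) e2 => //.
    + by rewrite /= hr0 hi hb0 kb /= /fit; have -> : 1 < wbound by lia.
    + apply: exec_Seq e1 _; apply: (@exec_Assign _ _ _ _ (Bin Add (Reg i) (Const 1))).
      rewrite /= /fit; have -> : 1 < wbound by lia.
      by rewrite /= hr1 hi1 addn1; have -> : k.+1 < wbound by lia.
have f0 : framed (i :: mod_regs c) (mod_vecs c) (mod_mats c) s (set_rg s i 0).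
  by apply: framed_set_rg; rewrite inE eqxx.
have hi0 : rg (set_rg s i 0) i = 0 by rewrite /= /update eqxx.
have [t [m' [s' [h T r f q]]]] :=
  loopP _ 0 _ _ (add0n _) (represents_set_rg 0 i0 i4 hm) hi0 f0 I0.
exists (2 + t), m', s'; split=> //; last exact: hQ.
- apply: exec_Seq h; apply: (@exec_Assign _ _ _ _ (Const 0)).
  by rewrite /= /fit; have -> : 0 < wbound by lia.
- rewrite /=; apply: leq_trans (_ : 2 + (4 + rg s b * (acost c + 8)) <= _) => //.
  by rewrite addnA leq_add2l leq_mul2r hb orbT.
Qed.

End ArrayLanguage.

(** * The program *)

(* Comparison of encoded distances, in which infinity is 0. *)
Definition enc_le (a b : nat) : bool := (0 < a) && (a <= b).

(* The edge {x, y} may carry the label with code [t]: no vertex [w] of the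
   distance matrix [d] sees exactly one of x and y before that time. *)
Definition safe (n : nat) (d : nat -> nat -> nat) (t x y : nat) : bool :=
  (0 < t) && all (fun w => enc_le (d w x) t == enc_le (d w y) t) (iota 0 n).

Definition edges_upto (k n : nat) (adj : nat -> nat -> nat) : seq (nat * nat) :=
  [seq e <- [seq (x, y) | x <- iota 0 k, y <- iota 0 n] | adj e.1 e.2 != 0].

Definition edge_list (n : nat) (adj : nat -> nat -> nat) : seq (nat * nat) :=
  edges_upto n n adj.

Definition usable (n : nat) (d adj : nat -> nat -> nat) (u : nat) : rel nat :=
  fun x y => ((x, y) \in edge_list n adj) && safe n d (d u y) x y.

Definition read_edges (s : astate) : seq (nat * nat) :=
  mkseq (fun k => (vc s 0 k, vc s 1 k)) (rg s 3).

(* Registers: 3 number of directed edges, 5 source u, 6 position k in the edge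
   list, 7 vertex w, 8 round, 9 bit, 10 and 11 ends x and y of an edge, 12 time,
   13 verdict, 14 number of output triples. Matrix 0 is D, matrix 1 the
   adjacency matrix, and matrix 2 holds at (u, y) the successor of the parent
   of y in the tree of u. Vectors 0 and 1 list the directed edges, vector 2 tells
   which of them are usable from u, and vector 3 is the output. *)
Definition le_expr (a b : aexpr) : aexpr :=
  EBin Mul (EBin Lt (ENat 0) a) (EBin Lt a (EBin Add b (ENat 1))).

Definition list_edges : acmd :=
  AFor 5 0 (AFor 11 0 (AIf (EMat 1 (EReg 5) (EReg 11))
    (ASeq (AVec 0 (EReg 3) (EReg 5))
    (ASeq (AVec 1 (EReg 3) (EReg 11))
          (ASet 3 (EBin Add (EReg 3) (ENat 1))))))).

Definition load_edge : acmd :=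
  ASeq (ASet 10 (EVec 0 (EReg 6))) (ASet 11 (EVec 1 (EReg 6))).

Definition check_safe : acmd :=
  ASeq (ASet 9 (EBin Lt (ENat 0) (EReg 12)))
    (AFor 7 0 (ASet 9 (EBin Mul (EReg 9)
      (EBin Eq (le_expr (EMat 0 (EReg 7) (EReg 10)) (EReg 12))
               (le_expr (EMat 0 (EReg 7) (EReg 11)) (EReg 12)))))).

Definition mark_usable : acmd :=
  AFor 6 3 (ASeq load_edge (ASeq (ASet 12 (EMat 0 (EReg 5) (EReg 11)))
    (ASeq check_safe (AVec 2 (EReg 6) (EReg 9))))).

Definition grow_tree : acmd :=
  AFor 8 0 (AFor 6 3 (ASeq load_edge
    (AIf (EBin Mul (EVec 2 (EReg 6))
           (EBin Mul (EBin Lt (ENat 0) (EMat 2 (EReg 5) (EReg 10)))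
                     (EBin Eq (EMat 2 (EReg 5) (EReg 11)) (ENat 0))))
       (AMat 2 (EReg 5) (EReg 11) (EBin Add (EReg 10) (ENat 1)))))).

Definition build_trees : acmd :=
  AFor 5 0 (ASeq mark_usable
    (ASeq (AMat 2 (EReg 5) (EReg 5) (EBin Add (EReg 5) (ENat 1))) grow_tree)).

Definition check_reached : acmd :=
  ASeq (ASet 13 (ENat 1))
    (AFor 5 0 (AFor 11 0
      (AIf (EBin Mul (EBin Lt (ENat 0) (EMat 0 (EReg 5) (EReg 11)))
                     (EBin Eq (EMat 2 (EReg 5) (EReg 11)) (ENat 0)))
         (ASet 13 (ENat 0))))).

Definition erase_copy (x y : nat) : acmd :=
  AIf (EBin Mul (EBin Eq (EMat 2 (EReg 7) (EReg y)) (EBin Add (EReg x) (ENat 1)))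
                (EBin Eq (EMat 0 (EReg 7) (EReg y)) (EReg 12)))
    (AMat 2 (EReg 7) (EReg y) (ENat 0)).

Definition erase_copies : acmd :=
  AFor 7 0 (ASeq (erase_copy 10 11) (erase_copy 11 10)).

Definition out_pos (j : nat) : aexpr :=
  EBin Add (EBin Mul (ENat 3) (EReg 14)) (ENat j).

Definition write_triple : acmd :=
  ASeq (AVec 3 (out_pos 0) (EReg 10))
  (ASeq (AVec 3 (out_pos 1) (EReg 11))
  (ASeq (AVec 3 (out_pos 2) (EBin Defs.Sub (EReg 12) (ENat 1)))
        (ASet 14 (EBin Add (EReg 14) (ENat 1))))).

(* Erasing all other parent entries that stand for the same label of the same
   edge makes every pair be written once. *)
Definition write_labels : acmd :=
  AFor 5 0 (AFor 6 3 (ASeq load_edge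
    (AIf (EBin Eq (EMat 2 (EReg 5) (EReg 11)) (EBin Add (EReg 10) (ENat 1)))
      (ASeq (ASet 12 (EMat 0 (EReg 5) (EReg 11)))
      (ASeq write_triple erase_copies))))).

Lemma safeS k d t x y :
  safe k.+1 d t x y = safe k d t x y && (enc_le (d k x) t == enc_le (d k y) t).
Proof. by rewrite /safe -[k.+1]addn1 iotaD all_cat /= andbT andbA. Qed.

Arguments safe : simpl never.
Local Arguments mkseq : simpl never.

Lemma edges_uptoS k n adj :
  edges_upto k.+1 n adj = edges_upto k n adj ++
    [seq e <- [seq (k, y) | y <- iota 0 n] | adj e.1 e.2 != 0].
Proof.
by rewrite /edges_upto -[k.+1]addn1 iotaD allpairs_cat filter_cat /= cats0.
Qed.

Lemma size_edges_upto k n adj : size (edges_upto k n adj) <= k * n.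
Proof.
rewrite size_filter; apply: leq_trans (count_size _ _) _.
by rewrite size_allpairs !size_iota.
Qed.

Lemma read_edges_push s x y :
  read_edges (set_rg (set_vc (set_vc s 0 (rg s 3) x) 1 (rg s 3) y) 3 (rg s 3 + 1))
  = rcons (read_edges s) (x, y).
Proof.
rewrite /read_edges /= /update eqxx addn1 mkseqS eqxx; congr rcons.
by apply/eq_in_map => k; rewrite mem_iota add0n => hk; rewrite ltn_eqF.
Qed.

Lemma read_edges_frame rs vs ms s s' : 3 \notin rs -> 0 \notin vs -> 1 \notin vs ->
  framed rs vs ms s s' -> read_edges s' = read_edges s.
Proof. by move=> h3 v0 v1 [hr hv _]; rewrite /read_edges hr // !hv. Qed.

Arguments edges_upto : simpl never.
Arguments read_edges : simpl never.

Definition tree_edge n d adj u (p : nat -> nat) : rel nat :=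
  fun x y => usable n d adj u x y && (p y == x.+1).

(* [p] is the successor of the parent function of a tree of usable edges rooted
   at [u], and 0 outside of the tree. *)
Definition usable_tree n d adj u (p : nat -> nat) : Prop :=
  forall y, y < n -> p y != 0 ->
    (y = u /\ p y = u.+1 \/ exists x, p y = x.+1 /\ usable n d adj u x y) /\
    exists q, path (tree_edge n d adj u p) u q /\ last u q = y.

Lemma usable_tree_root n d adj u p : p u = u.+1 ->
  (forall y, y < n -> y != u -> p y = 0) -> usable_tree n d adj u p.
Proof.
move=> pu p0 y yn; case: (eqVneq y u) => [-> _|yu]; last by rewrite p0.
by split; [left|exists [::]].
Qed.

Lemma usable_tree_add n d adj u p x y :
  usable_tree n d adj u p -> x < n -> p x != 0 -> usable n d adj u x y ->
  p y = 0 -> usable_tree n d adj u (fun z => if z == y then x.+1 else p z).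
Proof.
move=> hp xn px xy py z zn.
pose p' z := if z == y then x.+1 else p z; rewrite -/p' -/(p' z).
have sub q : path (tree_edge n d adj u p) u q -> path (tree_edge n d adj u p') u q.
  apply: sub_path => a b /andP [ab /eqP pb]; rewrite /tree_edge ab /p'.
  case: (eqVneq b y) => [e|_]; last by rewrite pb eqxx.
  by move: py; rewrite -e pb.
rewrite /(p' z); case: (eqVneq z y) => [-> _|zy pz].
- split; first by right; exists x.
  have [_ [q [hq lq]]] := hp _ xn px.
  exists (rcons q y); rewrite rcons_path last_rcons sub //= lq.
  by rewrite /tree_edge xy /p' !eqxx.
- have [h [q [hq lq]]] := hp _ zn pz; split; last by exists q; rewrite sub.
  by case: h => h; [left|right].
Qed.

Definition reachable n d adj u r y : Prop :=
  exists q, [/\ path (usable n d adj u) u q, last u q = y & size q <= r].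

Lemma mem_edge_list n adj x y :
  ((x, y) \in edge_list n adj) = [&& x < n, y < n & adj x y != 0].
Proof.
rewrite /edge_list /edges_upto mem_filter /= andbC andbA; congr (_ && _).
apply/allpairsP/andP => [[[a b] /= [ha hb [-> ->]]]|[ha hb]].
  by rewrite !mem_iota in ha hb *.
by exists (x, y); rewrite !mem_iota /= ha hb.
Qed.

Lemma usable_bound n d adj u x y : usable n d adj u x y -> x < n /\ y < n.
Proof. by rewrite /usable mem_edge_list => /andP [/and3P []]. Qed.

Lemma reachable_full n d adj u y q : u < n ->
  path (usable n d adj u) u q -> last u q = y -> reachable n d adj u n y.
Proof.
move=> un hq; case/shortenP: hq => q' hq' uq' _ lq; exists q'; split=> //.
suff : size (u :: q') <= size (iota 0 n) by rewrite size_iota => /ltnW.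
apply: uniq_leq_size => // z; rewrite inE mem_iota => /orP [/eqP -> //|zq].
have [i hi <-] := nthP 0 zq.
by have /(pathP 0)/(_ i hi)/usable_bound [] := hq'.
Qed.

Definition spanning_tree n d adj u p : Prop :=
  usable_tree n d adj u p /\
  (forall q, path (usable n d adj u) u q -> p (last u q) != 0).

Definition read_triples (s : astate) : seq (nat * nat * nat) :=
  mkseq (fun i => (vc s 3 (3 * i + 0), vc s 3 (3 * i + 1), vc s 3 (3 * i + 2)))
    (rg s 14).

Lemma read_triples_frame rs vs ms s s' : 14 \notin rs -> 3 \notin vs ->
  framed rs vs ms s s' -> read_triples s' = read_triples s.
Proof. by move=> h14 v3 [hr hv _]; rewrite /read_triples hr // !hv. Qed.

Definition edge_key (e : nat * nat * nat) : nat * nat * nat :=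
  (minn e.1.1 e.1.2, maxn e.1.1 e.1.2, e.2).

Lemma edge_keyE x y t x' y' t' : (edge_key (x, y, t) == edge_key (x', y', t')) =
  (t == t') && ((x == x') && (y == y') || (x == y') && (y == x')).
Proof. by rewrite /edge_key /= !xpair_eqE /=; lia. Qed.

Definition entry (d p : nat -> nat -> nat) (w z : nat) : nat * nat * nat :=
  ((p w z).-1, z, (d w z).-1).

Definition active (E : seq (nat * nat)) (p : nat -> nat -> nat) : rel nat :=
  fun w z => (0 < p w z) && (((p w z).-1, z) \in E).

Definition same_label (d p : nat -> nat -> nat) x y t w z : bool :=
  (d w z == t) &&
  ((z == y) && (p w z == x.+1) || (z == x) && (p w z == y.+1)).

Definition lists_entries n d p E (l : seq (nat * nat * nat)) : Prop :=
  [/\ uniq (map edge_key l),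
      forall e, e \in l ->
        exists w z, [/\ w < n, z < n, active E p w z & e = entry d p w z]
    & forall w z, w < n -> z < n -> active E p w z ->
        edge_key (entry d p w z) \in map edge_key l].

(* The invariant of the output loop: [l] has been written and [p] is what is
   left of [p0]. *)
Definition listed n d p0 E p l : Prop :=
  [/\ uniq (map edge_key l),
      forall e, e \in l ->
        exists w z, [/\ w < n, z < n, active E p0 w z & e = entry d p0 w z],
      forall w z, w < n -> z < n -> p w z = p0 w z \/
        p w z = 0 /\ edge_key (entry d p0 w z) \in map edge_key l
    & forall w z, w < n -> z < n -> active E p w z ->
        edge_key (entry d p0 w z) \notin map edge_key l].

Lemma listed_size n d p0 E p l u y : listed n d p0 E p l ->
  u < n -> y < n -> active E p u y -> size l < n * n.
Proof.
move=> [U S C N] un yn uy.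
pose keys := [seq edge_key (entry d p0 w z) | w <- iota 0 n, z <- iota 0 n].
have inkeys w z : w < n -> z < n -> edge_key (entry d p0 w z) \in keys.
  by move=> wn zn; apply: allpairs_f; rewrite mem_iota.
have <- : size keys = n * n by rewrite size_allpairs !size_iota.
rewrite -(size_map edge_key).
apply: (@uniq_leq_size _ (edge_key (entry d p0 u y) :: map edge_key l)).
  by rewrite /= N.
move=> k; rewrite inE => /orP [/eqP -> |/mapP [e /S [w [z [wn zn _ ->]]] ->]];
  exact: inkeys.
Qed.

Lemma listed_step n d p0 E p l u x y : listed n d p0 E p l ->
  (forall w z, w < n -> z < n -> active E p0 w z -> 0 < d w z) ->
  u < n -> y < n -> p u y = x.+1 -> (x, y) \in E ->
  listed n d p0 E
    (fun w z => if (w < n) && same_label d p x y (d u y) w z then 0 else p w z)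
    (rcons l (x, y, (d u y).-1)).
Proof.
move=> [U S C N] dpos un yn puy xyE.
have auy : active E p u y by rewrite /active puy.
have p0uy : p0 u y = x.+1 by case: (C _ _ un yn); rewrite puy // => -[].
have a0uy : active E p0 u y by rewrite /active p0uy.
have entE : entry d p0 u y = (x, y, (d u y).-1) by rewrite /entry p0uy.
have sameP w z : w < n -> z < n -> active E p w z ->
    (edge_key (entry d p0 w z) == edge_key (entry d p0 u y)) =
    same_label d p x y (d u y) w z.
  move=> wn zn /andP [pwz Ewz].
  have p0wz : p0 w z = p w z by case: (C _ _ wn zn) => [//|[e]]; rewrite e in pwz.
  have dwz : 0 < d w z by apply: dpos => //; rewrite /active p0wz pwz.
  have duy := dpos _ _ un yn a0uy.
  by rewrite entE edge_keyE /same_label p0wz; lia.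
have mapE : map edge_key (rcons l (x, y, (d u y).-1)) =
    rcons (map edge_key l) (edge_key (entry d p0 u y)) by rewrite map_rcons entE.
split.
- by rewrite mapE rcons_uniq N.
- move=> e; rewrite mem_rcons inE => /orP [/eqP -> |/S //].
  by exists u, y.
- move=> w z wn zn; rewrite mapE mem_rcons inE wn /=.
  case: ifP => [same|_]; last first.
    by case: (C _ _ wn zn) => [|[-> ->]]; rewrite ?orbT; [left|right].
  right; split=> //; case: (C _ _ wn zn) => [e|[_ ->]]; last by rewrite orbT.
  rewrite [X in X || _](_ : _ = true) // entE edge_keyE -e.
  by move: same; rewrite /same_label; lia.
- move=> w z wn zn; rewrite /active wn /= mapE mem_rcons inE.
  case: ifP => // same awz.
  by rewrite negb_or N // sameP // same.
Qed.

Lemma set_mtE s i x y v :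
  mt (set_mt s i x y v) i x = fun z => if z == y then v else mt s i x z.
Proof. by apply/funext => z; rewrite /= !eqxx. Qed.

Definition realize_cmd : acmd :=
  ASeq list_edges (ASeq build_trees (ASeq check_reached write_labels)).

(* [p] has one row per source. *)
Definition realize_spec n d adj (p : nat -> nat -> nat) (verdict : bool) l : Prop :=
  [/\ forall u, u < n -> spanning_tree n d adj u (p u),
      verdict <-> (forall u y, u < n -> y < n -> d u y != 0 -> p u y != 0)
    & lists_entries n d p (edge_list n adj) l].

Ltac solve_defined :=
  rewrite /= /update /=; repeat split; rewrite ?addn1 ?addn0 //; try lia.

Section Phases.
Variables n K space wbound : nat.
Hypothesis space_big : 15 * (n * n) <= space.
Hypothesis wbound_big : 15 * (n * n) + K + n + 16 < wbound.

Notation arun := (arun n K space wbound).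
Notation for_run I := (@arun_for n K space wbound space_big wbound_big I).
Notation set_run := (arun_set space_big wbound_big).
Notation vec_run := (arun_vec space_big wbound_big).
Notation mat_run := (arun_mat space_big wbound_big).
Notation if_run := (arun_if space_big wbound_big).

Lemma arun_regs c s (Q : astate -> Prop) :
  (rg s 0 = n -> rg s 4 = n * n -> arun c s Q) -> arun c s Q.
Proof. by move=> h m hm; have [_ h0 h4 _ _] := hm; apply: h. Qed.

Lemma check_safe_run s :
  (forall u y, u < n -> y < n -> mt s 0 u y + 1 < wbound) ->
  rg s 10 < n -> rg s 11 < n -> rg s 12 + 1 < wbound ->
  arun check_safe s (fun s' =>
    rg s' 9 = safe n (mt s 0) (rg s 12) (rg s 10) (rg s 11)).
Proof.
move=> dW hx hy ht; apply: arun_regs => h0 h4.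
apply: arun_seq; apply: set_run => //; first by solve_defined.
apply: (for_run (fun k s' =>
  rg s' 9 = safe k (mt s 0) (rg s 12) (rg s 10) (rg s 11))) => //.
- by rewrite /= /update /= h0.
- by rewrite /safe /= /update /= andbT.
- move=> k s'; rewrite /= {1}/update /= h0 => kn hk [hr hv hm] hI.
  have r10 : rg s' 10 = rg s 10 by rewrite hr.
  have r11 : rg s' 11 = rg s 11 by rewrite hr.
  have r12 : rg s' 12 = rg s 12 by rewrite hr.
  have m0 : mt s' 0 = mt s 0 by rewrite hm.
  have d1 := dW _ _ kn hx; have d2 := dW _ _ kn hy.
  apply: set_run => //.
    by solve_defined; rewrite ?hk ?r10 ?r11 ?r12 ?m0 ?addn1 //; lia.
  rewrite safeS /= /update /= hk r10 r11 r12 m0 hI.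
  by rewrite !addn1 !ltnS !mulnb; congr (nat_of_bool (_ && _));
    rewrite /enc_le; do 2!case: (_ && _).
- by move=> s' _; rewrite /= /update /= h0.
Qed.
Lemma list_edges_run s : rg s 3 = 0 ->
  arun list_edges s (fun s' => read_edges s' = edge_list n (mt s 1)).
Proof.
move=> r3; apply: arun_regs => h0 h4.
have m1 s1 rs vs : framed rs vs [::] s s1 -> mt s1 1 = mt s 1.
  by case=> _ _ ->.
apply: (for_run (fun k s' => read_edges s' = edges_upto k n (mt s 1))) => //.
- by rewrite h0.
- by rewrite /read_edges /= /update /= r3.
- move=> u s1; rewrite h0 => un hu fr hI; have hm := m1 _ _ _ fr.
  have [hr _ _] := fr.
  have h01 : rg s1 0 = n by rewrite hr.
  apply: (for_run (fun k s' => read_edges s' = edges_upto u n (mt s 1) ++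
      [seq e <- [seq (u, y) | y <- iota 0 k] | mt s 1 e.1 e.2 != 0])) => //.
  + by rewrite h01.
  + by rewrite cats0.
  + move=> y s2; rewrite h01 => yn hy fr2 hI2.
    have hm2 : mt s2 1 = mt s 1 by case: fr2 => _ _ -> //.
    have hu2 : rg s2 5 = u by case: fr2 => -> //.
    have r3N : rg s2 3 < n * n.
      have -> : rg s2 3 = size (read_edges s2) by rewrite size_mkseq.
      rewrite hI2 size_cat; apply: leq_ltn_trans (index_bound un yn).
      apply: leq_add; first exact: size_edges_upto.
      by rewrite size_filter (leq_trans (count_size _ _)) // size_map size_iota.
    rewrite -[y.+1]addn1 iotaD map_cat filter_cat catA -hI2 /= ?add0n.
    apply: if_run; first by solve_defined; rewrite ?hu2 ?hy.
    * rewrite /= hu2 hy hm2 => /negPf e.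
      apply: arun_seq; apply: vec_run; [by solve_defined|by []|].
      apply: arun_seq; apply: vec_run; [by solve_defined|by []|].
      apply: set_run => //; first by solve_defined.
      by have := read_edges_push s2 u y; rewrite /= hu2 hy e -cats1 => <-.
    * by rewrite /= hu2 hy hm2 => ->; rewrite cats0.
  + by move=> s2 _; rewrite h01 edges_uptoS => e; apply: e.
- by move=> s1 _; rewrite h0.
Qed.

Hypothesis K_small : K <= n * n.

Definition ready (s : astate) : Prop :=
  [/\ rg s 3 = K, forall k, k < K -> vc s 0 k < n /\ vc s 1 k < n
    & forall u y, u < n -> y < n -> mt s 0 u y + 1 < wbound].

Lemma ready_frame rs vs ms s s' :
  3 \notin rs -> 0 \notin vs -> 1 \notin vs -> 0 \notin ms ->
  framed rs vs ms s s' -> ready s -> ready s'.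
Proof.
by move=> r3 v0 v1 m0 [hr hv hm] [h1 h2 h3]; split; rewrite ?hr ?hm ?hv.
Qed.

Lemma load_edge_run s (Q : astate -> Prop) : rg s 6 < K ->
  Q (set_rg (set_rg s 10 (vc s 0 (rg s 6))) 11 (vc s 1 (rg s 6))) ->
  arun load_edge s Q.
Proof.
move=> hk hQ; apply: arun_seq; apply: set_run => //; first by solve_defined.
by apply: set_run => //; solve_defined.
Qed.

Lemma mark_usable_run s : ready s -> rg s 5 < n ->
  arun mark_usable s (fun s' => forall k, k < K ->
    vc s' 2 k = safe n (mt s 0) (mt s 0 (rg s 5) (vc s 1 k)) (vc s 0 k) (vc s 1 k)).
Proof.
move=> rdy un; have [r3 bnd dW] := rdy.
apply: (for_run (fun j s' => forall k, k < j -> vc s' 2 k =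
  safe n (mt s 0) (mt s 0 (rg s 5) (vc s 1 k)) (vc s 0 k) (vc s 1 k))) => //.
- by rewrite r3.
- move=> k s1; rewrite r3 => kK hk fr hI.
  have rdy1 : ready s1 by apply: ready_frame fr rdy.
  have [hr hv hm] := fr.
  have [xn yn] := bnd _ kK.
  apply: arun_seq; apply: load_edge_run; rewrite ?hk //.
  have [r31 bnd1 dW1] := rdy1.
  have h5 : rg s1 5 = rg s 5 by rewrite hr.
  have h0 : vc s1 0 = vc s 0 by rewrite hv.
  have h1 : vc s1 1 = vc s 1 by rewrite hv.
  have hm0 : mt s1 0 = mt s 0 by rewrite hm.
  apply: arun_seq; apply: set_run => //.
    by solve_defined; rewrite ?h5 ?h0 ?h1.
  apply: arun_seq; rewrite /= /update /= h0 h1 h5 hm0.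
  apply: arun_weaken (check_safe_run _ _ _ _) _ => //=; rewrite ?hm0 //.
    by apply: dW.
  move=> s2 [hr2 hv2 hm2]; rewrite /update /= => e.
  have h62 : rg s2 6 = k by rewrite hr2.
  apply: vec_run; [by solve_defined; rewrite ?h62; lia|by []|].
  move=> j; rewrite ltnS leq_eqVlt /= h62 e.
  case: eqVneq => [-> _|_ /= jk]; first by [].
  by rewrite hv2 //= hI.
- by move=> s1 _; rewrite r3.
Qed.

Lemma edge_position adj s : ready s -> read_edges s = edge_list n adj ->
  forall x y, (x, y) \in edge_list n adj <->
    exists k, [/\ k < K, vc s 0 k = x & vc s 1 k = y].
Proof.
move=> [r3 _ _] he x y; rewrite -he /read_edges r3; split.
- by case/mapP => k; rewrite mem_iota => hk [-> ->]; exists k.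
- move=> [k [hk <- <-]]; apply/mapP; exists k => //.
  by rewrite mem_iota.
Qed.

Lemma grow_tree_run adj s (d := mt s 0) (u := rg s 5) :
  ready s -> u < n -> read_edges s = edge_list n adj ->
  (forall k, k < K ->
     vc s 2 k = safe n d (d u (vc s 1 k)) (vc s 0 k) (vc s 1 k)) ->
  usable_tree n d adj u (mt s 2 u) -> mt s 2 u u != 0 ->
  arun grow_tree s (fun s' => spanning_tree n d adj u (mt s' 2 u) /\
    forall u', u' != u -> mt s' 2 u' = mt s 2 u').
Proof.
move=> rdy un hE hB hT hroot; apply: arun_regs => rg0 _; have [r3 bnd dW] := rdy.
have posE := edge_position rdy hE.
apply: (for_run (fun r s' => [/\ usable_tree n d adj u (mt s' 2 u),
    forall y, reachable n d adj u r y -> mt s' 2 u y != 0 &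
    forall u', u' != u -> mt s' 2 u' = mt s 2 u'])) => //.
- by rewrite rg0.
- split=> // y [q [_ <-]]; rewrite leqn0 => /nilP -> //.
- move=> r s1; rewrite rg0 => rn hr fr [T1 R1 O1].
  have rdy1 : ready s1 by apply: ready_frame fr rdy.
  have [hrg hv hm] := fr.
  have v0 : vc s1 0 = vc s 0 by rewrite hv.
  have v1 : vc s1 1 = vc s 1 by rewrite hv.
  have v2 : vc s1 2 = vc s 2 by rewrite hv.
  have r31 : rg s1 3 = K by rewrite hrg.
  have r51 : rg s1 5 = u by rewrite hrg.
  apply: (for_run (fun k s' => [/\ usable_tree n d adj u (mt s' 2 u),
    (forall y, reachable n d adj u r y -> mt s' 2 u y != 0),
    forall j, j < k -> usable n d adj u (vc s 0 j) (vc s 1 j) ->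
      reachable n d adj u r (vc s 0 j) -> mt s' 2 u (vc s 1 j) != 0 &
    forall u', u' != u -> mt s' 2 u' = mt s 2 u'])) => //.
  + by rewrite r31.
  + move=> k s2; rewrite r31 => kK hk fr2 [T2 R2 E2 O2].
    have rdy2 : ready s2 by apply: ready_frame fr2 rdy1.
    have [hr2 hv2 hm2] := fr2.
    have w0 : vc s2 0 = vc s 0 by rewrite hv2.
    have w1 : vc s2 1 = vc s 1 by rewrite hv2.
    have w2 : vc s2 2 = vc s 2 by rewrite hv2.
    have r52 : rg s2 5 = u by rewrite hr2.
    have [xn yn] := bnd _ kK.
    have kU : usable n d adj u (vc s 0 k) (vc s 1 k) = (vc s 2 k != 0).
      rewrite hB // eqb0 negbK /usable.
      by have -> : (vc s 0 k, vc s 1 k) \in edge_list n adj by apply/posE; exists k.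
    have B1 : vc s 2 k <= 1 by rewrite hB //; case: safe.
    apply: arun_seq; apply: load_edge_run; rewrite ?hk //.
    rewrite w0 w1; apply: if_run.
    * solve_defined; rewrite ?hk ?r52 ?w2 //; try lia.
    * rewrite /= /update /= hk r52 w2.
      rewrite muln_eq0 mulnb eqb0 negb_or negbK lt0n.
      move=> /and3P [kB px /eqP py].
      pose s3 := set_mt s2 2 u (vc s 1 k) (vc s 0 k).+1.
      have e3 : mt s3 2 u =
          fun z => if z == vc s 1 k then (vc s 0 k).+1 else mt s2 2 u z.
        exact: set_mtE.
      have keep y : mt s2 2 u y != 0 ->
          (if y == vc s 1 k then (vc s 0 k).+1 else mt s2 2 u y) != 0.
        by case: ifP.
      suff fin : [/\ usable_tree n d adj u (mt s3 2 u),
          (forall y, reachable n d adj u r y -> mt s3 2 u y != 0),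
          forall j, j < k.+1 -> usable n d adj u (vc s 0 j) (vc s 1 j) ->
            reachable n d adj u r (vc s 0 j) -> mt s3 2 u (vc s 1 j) != 0 &
          forall u', u' != u -> mt s3 2 u' = mt s 2 u'].
        apply: mat_run; [|by solve_defined; rewrite ?r52; lia|].
          by solve_defined; rewrite ?r52.
        rewrite [aeval _ _]/= [aeval _ (EReg 11)]/= [aeval _ (EBin _ _ _)]/=.
        by rewrite /update /= r52 addn1.
      split.
      - rewrite e3; apply: usable_tree_add => //.
        by rewrite kU.
      - by move=> y hy; rewrite e3; apply/keep/R2.
      - move=> j; rewrite ltnS leq_eqVlt e3 => /orP [/eqP -> _ _|jk hU hR].
          by rewrite eqxx.
        exact/keep/E2.
      - move=> u' hu'; rewrite -O2 //; apply/funext => z.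
        by rewrite /= (negPf hu').
    * rewrite /= /update /= hk r52 w2 => cnd; split=> //.
      move=> j; rewrite ltnS leq_eqVlt => /orP [/eqP -> |]; last exact: E2.
      rewrite kU => kB /R2 px; apply/negP => py.
      move: cnd; rewrite py muln1 lt0n px muln1 => e.
      by rewrite e in kB.
  + move=> s2 fr2; rewrite r31 => -[T2 R2 E2 O2]; split=> // y [q [hq lq sq]].
    move: hq lq sq; case/lastP: q => [|q z].
      by move=> _ <- _; apply: R2; exists [::].
    rewrite rcons_path last_rcons size_rcons ltnS => /andP [hq xz] <- sq.
    have /posE [k [kK xk yk]] : (last u q, z) \in edge_list n adj by case/andP: xz.
    have := E2 _ kK; rewrite xk yk => h; apply: h => //.
    by exists q.
- move=> s1 fr; rewrite rg0 => -[T1 R1 O1]; split=> //; split=> // q hq.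
  by apply: R1; apply: reachable_full hq _.
Qed.

Lemma build_trees_run adj s (d := mt s 0) :
  ready s -> read_edges s = edge_list n adj ->
  (forall u y, u < n -> y < n -> mt s 2 u y = 0) ->
  arun build_trees s (fun s' =>
    forall u, u < n -> spanning_tree n d adj u (mt s' 2 u)).
Proof.
move=> rdy hE h0; apply: arun_regs => rg0 _.
apply: (for_run (fun k s' =>
  (forall u, u < k -> spanning_tree n d adj u (mt s' 2 u)) /\
  forall u, k <= u -> mt s' 2 u = mt s 2 u)) => //.
- by rewrite rg0.
- move=> u s1; rewrite rg0 => un hu fr [T1 O1].
  have rdy1 : ready s1 by apply: ready_frame fr rdy.
  have [hr hv hm] := fr.
  have m01 : mt s1 0 = d by rewrite hm.
  apply: arun_seq; apply: arun_weaken (mark_usable_run rdy1 _) _; rewrite ?hu //.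
  move=> s2 fr2; rewrite m01 => B2; have [hr2 hv2 hm2] := fr2.
  have rdy2 : ready s2 by apply: ready_frame fr2 rdy1.
  have u2 : rg s2 5 = u by rewrite hr2.
  have m2 : mt s2 2 = mt s1 2 by rewrite hm2.
  have m02 : mt s2 0 = d by rewrite hm2.
  have w0 : vc s2 0 = vc s1 0 by rewrite hv2.
  have w1 : vc s2 1 = vc s1 1 by rewrite hv2.
  pose s3 := set_mt s2 2 u u u.+1.
  suff fin : arun grow_tree s3 (fun s' =>
      (forall u', u' < u.+1 -> spanning_tree n d adj u' (mt s' 2 u')) /\
      forall u', u.+1 <= u' -> mt s' 2 u' = mt s 2 u').
    apply: arun_seq; apply: mat_run; [|by solve_defined; rewrite u2; lia|].
      by solve_defined; rewrite u2.
    by rewrite [aeval _ (EReg 5)]/= [aeval _ (EBin _ _ _)]/= u2 addn1.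
  have e3 : mt s3 2 u = fun z => if z == u then u.+1 else mt s2 2 u z by exact: set_mtE.
  have o3 u' : u' != u -> mt s3 2 u' = mt s1 2 u'.
    by move=> /negPf hu'; rewrite -m2; apply/funext => z; rewrite /= hu'.
  have m03 : mt s3 0 = d by rewrite -m02.
  have u3 : rg s3 5 = u by [].
  have rdy3 : ready s3 by have [? ? ?] := rdy2.
  have hE3 : read_edges s3 = edge_list n adj.
    have -> : read_edges s3 = read_edges s2 by [].
    by rewrite (read_edges_frame _ _ _ fr2) // (read_edges_frame _ _ _ fr).
  apply: arun_weaken (grow_tree_run rdy3 _ hE3 _ _ _) _; rewrite ?m03 ?u3 //.
  + by move=> k kK; rewrite -[vc s3]/(vc s2) B2 // w0 w1.
  + apply: usable_tree_root; first by rewrite e3 eqxx.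
    by move=> y yn /negPf yu; rewrite e3 yu m2 O1 // h0.
  + by rewrite e3 eqxx.
  + move=> s4 _ [T4 O4]; split=> u' hu'.
    * case: (eqVneq u' u) => [-> //|neq].
      by rewrite O4 // o3 //; apply: T1; lia.
    * by rewrite O4 ?o3 ?O1 //; lia.
- by move=> s1 _; rewrite rg0 => -[].
Qed.

Lemma check_reached_run s :
  arun check_reached s (fun s' => (rg s' 13 != 0) <->
    forall u y, u < n -> y < n -> mt s 0 u y != 0 -> mt s 2 u y != 0).
Proof.
apply: arun_regs => rg0 _.
apply: arun_seq; apply: set_run => //; first by solve_defined.
apply: (for_run (fun k s' => (rg s' 13 != 0) <->
  forall u y, u < k -> y < n -> mt s 0 u y != 0 -> mt s 2 u y != 0)) => //.
- by rewrite /= /update /= rg0.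
- move=> u s1; rewrite /= /update /= rg0 => un hu [hr _ hm] hI.
  have r01 : rg s1 0 = n by rewrite hr.
  have m1 : mt s1 = mt s by apply/funext => i; rewrite hm.
  apply: (for_run (fun k s' => (rg s' 13 != 0) <->
    (forall u y, u < rg s1 5 -> y < n -> mt s 0 u y != 0 -> mt s 2 u y != 0) /\
    forall y, y < k -> mt s 0 u y != 0 -> mt s 2 u y != 0)) => //.
  + by rewrite r01.
  + by rewrite hu; split=> [/hI|[/hI]].
  + move=> y s2; rewrite r01 => yn hy [hr2 _ hm2] hI2.
    have m2 : mt s2 = mt s by apply/funext => i; rewrite hm2 // m1.
    have u2 : rg s2 5 = u by rewrite hr2.
    apply: if_run; first by solve_defined; rewrite ?u2 ?hy.
    * rewrite /= hy u2 m2 mulnb eqb0 negbK lt0n => /andP [dy /eqP py].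
      apply: set_run => //; first by solve_defined.
      rewrite /= /update /=; split=> // -[_ h].
      by have := h y (ltnSn y) dy; rewrite py.
    * rewrite /= hy u2 m2 mulnb => /eqP; rewrite eqb0 negb_and /update /= => cnd.
      rewrite hI2; split=> -[h1 h2]; split=> // z hz; last by apply: h2; lia.
      move: hz; rewrite ltnS leq_eqVlt => /orP [/eqP -> dy|]; last exact: h2.
      by move: cnd; rewrite lt0n dy.
  + move=> s2 _; rewrite r01 hu => hI2; rewrite /= /update /= hI2.
    split=> [[h1 h2] v y hv yn|h].
    * by move: hv; rewrite ltnS leq_eqVlt => /orP [/eqP ->|hv]; [apply: h2|apply: h1].
    * by split=> [v y hv|y] yn; apply: h => //; lia.
- by move=> s1 _; rewrite /= /update /= rg0.
Qed.

Lemma write_triple_run s :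
  rg s 14 < n * n -> rg s 12 < wbound ->
  arun write_triple s (fun s' => read_triples s' =
    rcons (read_triples s) (rg s 10, rg s 11, (rg s 12).-1)).
Proof.
move=> h14 h12.
apply: arun_seq; apply: vec_run; [by solve_defined|by []|].
apply: arun_seq; apply: vec_run; [by solve_defined|by []|].
apply: arun_seq; apply: vec_run; [by solve_defined|by solve_defined|].
apply: set_run => //; first by solve_defined.
rewrite /read_triples /= /update /= [rg s 14 + 1]addn1 mkseqS; congr rcons.
  apply/eq_in_map => i; rewrite mem_iota add0n => hi.
  by congr (_, _, _); rewrite !ifF //; lia.
rewrite subn1; congr (_, _, _); do ?[rewrite ifF; last by lia];
  by rewrite ifT //; lia.
Qed.

Lemma erase_copy_run i j s : rg s 7 < n -> rg s j < n -> rg s i < n ->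
  arun (erase_copy i j) s (fun s' => mt s' 2 = fun w z =>
    if [&& w == rg s 7, z == rg s j, mt s 2 w z == (rg s i).+1
         & mt s 0 w z == rg s 12] then 0 else mt s 2 w z).
Proof.
move=> h7 hj hi; apply: if_run; first by solve_defined.
- rewrite /= mulnb eqb0 negbK addn1 => /andP [c1 c2].
  apply: mat_run; [by solve_defined|by solve_defined; lia|].
  apply/funext => w; apply/funext => z /=.
  case: eqVneq => //= ->; case: eqVneq => //= ->.
  by rewrite c1 c2.
- rewrite /= mulnb => /eqP; rewrite eqb0 addn1 => cnd.
  apply/funext => w; apply/funext => z.
  case: eqVneq => //= ->; case: eqVneq => //= ->.
  by rewrite (negPf cnd).
Qed.

Lemma erase_copies_run s : rg s 10 < n -> rg s 11 < n ->
  arun erase_copies s (fun s' => mt s' 2 = fun w z =>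
    if (w < n) && same_label (mt s 0) (mt s 2) (rg s 10) (rg s 11) (rg s 12) w z
    then 0 else mt s 2 w z).
Proof.
move=> h10 h11; apply: arun_regs => rg0 _.
apply: (for_run (fun k s' => mt s' 2 = fun w z =>
  if (w < k) && same_label (mt s 0) (mt s 2) (rg s 10) (rg s 11) (rg s 12) w z
  then 0 else mt s 2 w z)) => //.
- by rewrite rg0.
- move=> k s1; rewrite rg0 => kn hk [hr _ hm] hI.
  have r10 : rg s1 10 = rg s 10 by rewrite hr.
  have r11 : rg s1 11 = rg s 11 by rewrite hr.
  have r12 : rg s1 12 = rg s 12 by rewrite hr.
  have m0 : mt s1 0 = mt s 0 by rewrite hm.
  apply: arun_seq; apply: arun_weaken (erase_copy_run _ _ _) _; rewrite ?hk ?r10 ?r11 //.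
  move=> s2 [hr2 _ hm2] h2.
  have q7 : rg s2 7 = k by rewrite hr2.
  have q10 : rg s2 10 = rg s 10 by rewrite hr2.
  have q11 : rg s2 11 = rg s 11 by rewrite hr2.
  have q12 : rg s2 12 = rg s 12 by rewrite hr2.
  have q0 : mt s2 0 = mt s 0 by rewrite hm2.
  apply: arun_weaken (erase_copy_run _ _ _) _; rewrite ?q7 ?q10 ?q11 //.
  move=> s3 _ h3; rewrite [LHS]h3 h2 hI q0 m0 q12 r12.
  apply/funext => w; apply/funext => z.
  have -> : (w < k.+1) = (w == k) || (w < k) by rewrite ltnS leq_eqVlt.
  case: (eqVneq w k) => [->|wk] //=; rewrite ltnn /= /same_label.
  case: (z == rg s 10); case: (z == rg s 11); case: (mt s 0 k z == _);
    case: (mt s 2 k z == (rg s 10).+1) => //=;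
    by case: (mt s 2 k z == (rg s 11).+1).
- by move=> s1 _; rewrite rg0.
Qed.

Lemma write_labels_run adj s (d := mt s 0) (p0 := mt s 2) (E := edge_list n adj) :
  ready s -> read_edges s = E -> rg s 14 = 0 ->
  (forall w z, w < n -> z < n -> active E p0 w z -> 0 < d w z) ->
  arun write_labels s (fun s' => lists_entries n d p0 E (read_triples s') /\
    rg s' 14 <= n * n).
Proof.
move=> rdy hE h14 dpos; apply: arun_regs => rg0 _.
have posE := edge_position rdy hE; have [r3 bnd dW] := rdy.
pose done_row s' u j := forall i, i < j -> mt s' 2 u (vc s 1 i) != (vc s 0 i).+1.
apply: (for_run (fun k s' =>
  [/\ listed n d p0 E (mt s' 2) (read_triples s'), rg s' 14 <= n * n
    & forall u, u < k -> done_row s' u K])) => //.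
- by rewrite rg0.
- split=> //; rewrite /read_triples /= /update /= h14 //.
  by split=> // w z _ _; left.
- move=> u s1; rewrite rg0 => un hu fr [L1 c1 D1].
  have rdy1 : ready s1 by apply: ready_frame fr rdy.
  have [hr hv hm] := fr.
  have v0 : vc s1 0 = vc s 0 by rewrite hv.
  have v1 : vc s1 1 = vc s 1 by rewrite hv.
  have r31 : rg s1 3 = K by rewrite hr.
  have m01 : mt s1 0 = d by rewrite hm.
  apply: (for_run (fun k s' =>
    [/\ listed n d p0 E (mt s' 2) (read_triples s'), rg s' 14 <= n * n,
        forall u', u' < u -> done_row s' u' K & done_row s' u k])) => //.
  + by rewrite r31.
  + move=> k s2; rewrite r31 => kK hk fr2 [L2 c2 D2 E2].
    have rdy2 : ready s2 by apply: ready_frame fr2 rdy1.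
    have [hr2 hv2 hm2] := fr2.
    have w0 : vc s2 0 = vc s 0 by rewrite hv2.
    have w1 : vc s2 1 = vc s 1 by rewrite hv2.
    have u2 : rg s2 5 = u by rewrite hr2.
    have m02 : mt s2 0 = d by rewrite hm2.
    have [xn yn] := bnd _ kK.
    have kE : (vc s 0 k, vc s 1 k) \in E by apply/posE; exists k.
    apply: arun_seq; apply: load_edge_run; rewrite ?hk // w0 w1.
    set x := vc s 0 k in xn kE *; set y := vc s 1 k in yn kE *.
    apply: if_run.
    * by solve_defined; rewrite ?u2; lia.
    * rewrite /= /update /= u2 addn1 eqb0 negbK => /eqP puy.
      have duW : d u y + 1 < wbound by apply: dW.
      have sz : rg s2 14 < n * n.
        have -> : rg s2 14 = size (read_triples s2) by rewrite size_mkseq.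
        apply: (listed_size L2 un yn).
        by rewrite /active puy.
      apply: arun_seq; apply: set_run => //; first by solve_defined; rewrite ?u2.
      pose s3 := set_rg (set_rg (set_rg s2 10 x) 11 y) 12 (d u y).
      suff fin : arun (ASeq write_triple erase_copies) s3 (fun s' =>
          [/\ listed n d p0 E (mt s' 2) (read_triples s'), rg s' 14 <= n * n,
           forall u', u' < u -> done_row s' u' K & done_row s' u k.+1]).
        by rewrite [aeval _ _]/= /update /= u2 m02.
      apply: arun_seq; apply: arun_weaken (write_triple_run _ _) _ => //=.
        by rewrite /update /=; lia.
      rewrite /update /= => s4 fr4 t4; have [hr4 _ hm4] := fr4.
      have r104 : rg s4 10 = x by rewrite hr4.
      have r114 : rg s4 11 = y by rewrite hr4.
      have r124 : rg s4 12 = d u y by rewrite hr4.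
      have m04 : mt s4 0 = d by rewrite hm4.
      have m24 : mt s4 2 = mt s2 2 by rewrite hm4.
      have r144 : rg s4 14 = (rg s2 14).+1.
        have := congr1 size t4; rewrite size_rcons !size_mkseq; exact.
      apply: arun_weaken (erase_copies_run _ _) _; rewrite ?r104 ?r114 //.
      move=> s5 fr5; rewrite m04 r124 m24 => m25; have [hr5 _ _] := fr5.
      have less w z v : mt s2 2 w z != v.+1 -> mt s5 2 w z != v.+1.
        by rewrite m25; case: ifP.
      have step := listed_step L2 dpos un yn puy kE.
      split.
      - by rewrite (read_triples_frame _ _ fr5) // m25 t4; exact: step.
      - by rewrite hr5 // r144.
      - by move=> u' /D2 h i /h; apply: less.
      - move=> i; rewrite ltnS leq_eqVlt => /orP [/eqP -> |/E2]; last exact: less.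
        by rewrite m25 un /same_label !eqxx puy eqxx.
    * rewrite /= /update /= u2 addn1 => /eqP; rewrite eqb0 => puy; split=> // i.
      by rewrite ltnS leq_eqVlt => /orP [/eqP -> |/E2].
  + move=> s2 _; rewrite r31 => -[L2 c2 D2 E2]; split=> // u'.
    by rewrite ltnS leq_eqVlt => /orP [/eqP -> |/D2].
- move=> s1 _; rewrite rg0 => -[[U S C N] c1 D1]; split=> //; split=> // w z wn zn awz.
  case: (C _ _ wn zn) => [e|[]//].
  have /andP [pwz /posE [k [kK xk zk]]] := awz.
  have := D1 _ wn _ kK; rewrite zk e xk prednK ?eqxx //.
Qed.

Lemma realize_run s :
  K = size (edge_list n (mt s 1)) -> rg s 3 = 0 -> rg s 14 = 0 ->
  (forall u y, u < n -> y < n -> mt s 0 u y + 1 < wbound) ->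
  (forall u y, u < n -> y < n -> mt s 2 u y = 0) ->
  (forall u, u < n -> mt s 1 u u = 0) ->
  arun realize_cmd s (fun s' => exists p,
    realize_spec n (mt s 0) (mt s 1) p (rg s' 13 != 0) (read_triples s') /\
    rg s' 14 <= n * n).
Proof.
move=> KE h3 h14 dW p0 adj0; set d := mt s 0; set adj := mt s 1.
apply: arun_seq; apply: arun_weaken (list_edges_run h3) _.
move=> s1 [hr1 _ hm1] e1.
have d1 : mt s1 0 = d by rewrite hm1.
have r31 : rg s1 3 = K by rewrite KE -e1 size_mkseq.
have rdy1 : ready s1.
  split=> //; last by rewrite d1.
  move=> k kK.
  have : (vc s1 0 k, vc s1 1 k) \in edge_list n adj.
    by rewrite -e1; apply/mapP; exists k; rewrite ?mem_iota ?r31.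
  by rewrite mem_edge_list => /and3P [].
apply: arun_seq; apply: arun_weaken (build_trees_run rdy1 e1 _) _.
  by rewrite hm1.
move=> s2 fr2 T2; have [hr2 _ hm2] := fr2.
have d2 : mt s2 0 = d by rewrite hm2.
have rdy2 : ready s2 by apply: ready_frame fr2 rdy1.
have e2 : read_edges s2 = edge_list n adj by rewrite (read_edges_frame _ _ _ fr2).
apply: arun_seq; apply: (arun_weaken (check_reached_run (s := s2))).
move=> s3 fr3 V3; have [hr3 _ hm3] := fr3.
have d3 : mt s3 0 = d by rewrite hm3.
have p3 : mt s3 2 = mt s2 2 by rewrite hm3.
have rdy3 : ready s3 by apply: ready_frame fr3 rdy2.
have e3 : read_edges s3 = edge_list n adj by rewrite (read_edges_frame _ _ _ fr3).
have h143 : rg s3 14 = 0 by rewrite hr3 // hr2 // hr1.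
apply: arun_weaken (write_labels_run rdy3 e3 h143 _) _.
  move=> w z wn zn; rewrite p3 d3 => /andP [pwz Ewz].
  have [T _] := T2 _ wn.
  have [[[zw pE]|[x [_ /andP [_ /andP [+ _]]]]] _] := T z zn (lt0n_neq0 pwz).
    by move: Ewz; rewrite pE zw mem_edge_list /adj adj0 ?andbF.
  by rewrite d1.
move=> s4 [hr4 _ _] [L4 c4]; exists (mt s2 2); split=> //; split.
- by rewrite -d1.
- by rewrite hr4 // -d2.
- by rewrite -p3 -d3.
Qed.

End Phases.

(** * Safe labels *)

Definition by_time (a : option nat) (t : nat) : bool :=
  if a is Some k then k <= t else false.

Lemma by_time_inj a b : (forall t, by_time a t = by_time b t) -> a = b.
Proof.
case: a b => [j|] [k|] //= h.
- by congr Some; apply/eqP; rewrite eqn_leq -h leqnn h leqnn.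
- by have := h j; rewrite leqnn.
- by have := h k; rewrite leqnn.
Qed.

Lemma by_time_trans a s t : s <= t -> by_time a s -> by_time a t.
Proof. by case: a => //= k st ks; apply: leq_trans st. Qed.

Definition safe_label n (D : 'M[option nat]_n) (t : nat) (x y : 'I_n) : Prop :=
  forall w, by_time (D w x) t = by_time (D w y) t.

Definition ns_walk n (G : temporal_graph n) (u v : 'I_n) (t : nat) : Prop :=
  exists p, [/\ path (ns_hop G) (u, 0) p, last u (unzip1 p) = v
              & arrival (unzip2 p) <= t].

Lemma last_unzip (S T : Type) (x : S) (y : T) p :
  last (x, y) p = (last x (unzip1 p), last y (unzip2 p)).
Proof. by elim: p x y => //= -[x' y'] p IH x y; rewrite IH. Qed.

Section Walks.
Variables (n : nat) (G : temporal_graph n).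

Lemma ns_hop_relax (u : 'I_n) a b p : a <= b ->
  path (ns_hop G) (u, b) p -> path (ns_hop G) (u, a) p.
Proof.
case: p => //= [[v t] p] ab /andP [/and3P [/= h1 h2 h3] ->].
by rewrite andbT; apply/and3P; split=> //=; apply: leq_trans h3.
Qed.

(* Waiting at a repeated vertex instead of following the cycle. *)
Lemma ns_walk_shorten (u : 'I_n) a p : path (ns_hop G) (u, a) p ->
  exists p', [/\ path (ns_hop G) (u, a) p', uniq (u :: unzip1 p'),
    last u (unzip1 p') = last u (unzip1 p), last a (unzip2 p') <= last a (unzip2 p)
    & {subset unzip1 p' <= unzip1 p}].
Proof.
have [m] := ubnP (size p); elim: m u a p => // m IHm u a p sz hp.
case: (boolP (u \in unzip1 p)) => [up|up].
- have [[u' t] tp /= eu] := mapP up; subst u'.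
  have [p1 [p2 eqp]] : exists p1 p2, p = p1 ++ (u, t) :: p2.
    by case/splitPr: tp => p1 p2; exists p1, p2.
  move: sz hp; rewrite eqp size_cat /= => sz.
  rewrite cat_path /= => /and3P [h1 /and3P [_ _ h2] h3].
  have at_ : a <= t.
    have mono q b : path (ns_hop G) (u, b) q -> b <= last b (unzip2 q).
      move: (u) b; elim: q => //= -[v s] q IH u0 b /andP [/and3P [_ _ /= bs]] /IH.
      exact: leq_trans.
    by apply: leq_trans (mono _ _ h1) _; rewrite last_unzip in h2.
  have [|p' [q1 q2 q3 q4 q5]] := IHm u a p2 _ (ns_hop_relax at_ h3); first by lia.
  exists p'; split=> //.
  + by rewrite q3 /unzip1 map_cat last_cat.
  + apply: leq_trans q4 _; rewrite /unzip2 map_cat last_cat /=.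
    by case: (p2).
  + by move=> z /q5 hz; rewrite /unzip1 map_cat mem_cat /= inE hz !orbT.
- case: p sz hp up => [|[v t] p] /= sz hp up; first by exists [::].
  have /andP [hop hp'] := hp.
  have [|p' [q1 q2 q3 q4 q5]] := IHm v t p _ hp'; first by lia.
  exists ((v, t) :: p'); split=> //=.
  + by rewrite hop.
  + move: up q2; rewrite /= !inE !negb_or => /andP [-> up] ->; rewrite andbT /=.
    by apply: contra up; apply: q5.
  + by move=> z; rewrite !inE => /orP [-> //|/q5 ->]; rewrite orbT.
Qed.

Lemma by_time_NS_Fo u v t : by_time (NS_Fo G u v) t <-> ns_walk G u v t.
Proof.
rewrite mxE; case: eqVneq => [->|uv]; first by split=> // _; exists [::].
rewrite /min_or_infty; case: pselect => [exP|no] /=.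
- case: ex_minnP => m /asboolP [p /and3P [hp _ /eqP lp] ap] min; split.
    by move=> mt; exists p; split=> //; rewrite ap.
  move=> [q [hq lq aq]]; have [q' [h1 h2 h3 h4 _]] := ns_walk_shorten hq.
  apply: leq_trans (leq_trans h4 aq); apply: min; apply/asboolP.
  by exists q' => //; apply/and3P; split=> //; rewrite h3 lq.
- split=> // -[q [hq lq aq]]; have [q' [h1 h2 h3 h4 _]] := ns_walk_shorten hq.
  case: no; exists (arrival (unzip2 q')); apply/asboolP.
  by exists q' => //; apply/and3P; split=> //; rewrite h3 lq.
Qed.

Lemma ns_walk_step u x y t : ns_walk G u x t -> [set x; y] \in edges G ->
  t \in label G [set x; y] -> ns_walk G u y t.
Proof.
move=> [p [hp lp ap]] xy txy; exists (rcons p (y, t)); split.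
- by rewrite rcons_path hp last_unzip lp /ns_hop /= xy txy.
- by rewrite /unzip1 map_rcons last_rcons.
- by rewrite /arrival /unzip2 map_rcons last_rcons.
Qed.

Lemma NS_Fo_safe x y t : [set x; y] \in edges G -> t \in label G [set x; y] ->
  safe_label (NS_Fo G) t x y.
Proof.
move=> xy txy w; apply/idP/idP => /by_time_NS_Fo h; apply/by_time_NS_Fo.
  exact: ns_walk_step h xy txy.
by apply: ns_walk_step h _ _; rewrite setUC.
Qed.

Lemma safe_label_bound (D : 'M[option nat]_n) u v t :
  (forall x y s, [set x; y] \in edges G -> s \in label G [set x; y] ->
     safe_label D s x y) ->
  D u u = Some 0 -> ns_walk G u v t -> by_time (D u v) t.
Proof.
move=> safeG Duu [p [hp <- ap]]; apply: by_time_trans ap _.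
elim/last_ind: p hp => [|p [y s] IHp]; first by rewrite /= Duu.
rewrite rcons_path => /andP [/IHp h]; rewrite last_unzip => /and3P [/= xy sxy le].
rewrite /unzip1 /unzip2 !map_rcons last_rcons /arrival last_rcons /=.
by rewrite -(safeG _ _ _ xy sxy); apply: by_time_trans h.
Qed.

End Walks.

Section Trees.
Variables (n : nat) (D : 'M[option nat]_n) (Gp : static_graph n).
Variables d adj : nat -> nat -> nat.
Hypothesis dE : forall u v : 'I_n, d u v = encode_entry (D u v).
Hypothesis adjE : forall u v : 'I_n, adj u v = ([set u; v] \in edges Gp).

Lemma safeP t (x y : 'I_n) : reflect (safe_label D t x y) (safe n d t.+1 x y).
Proof.
have leE w z : enc_le (d (w : 'I_n) (z : 'I_n)) t.+1 = by_time (D w z) t.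
  by rewrite dE; case: (D w z).
apply: (iffP andP) => [[_ /allP h] w|h].
  by rewrite -!leE; apply/eqP/h; rewrite mem_iota /=.
split=> //; apply/allP => w; rewrite mem_iota add0n /= => hw.
by have := h (Ordinal hw); rewrite -!leE => /= ->.
Qed.

Lemma usableP (u x y : 'I_n) : usable n d adj u x y <->
  [set x; y] \in edges Gp /\ exists2 t, D u y = Some t & safe_label D t x y.
Proof.
rewrite /usable mem_edge_list !ltn_ord adjE eqb0 negbK dE /=; split.
- case/andP => xy; case: (D u y) => [t|] //= /safeP h.
  by split=> //; exists t.
- by move=> [xy [t -> /safeP h]]; rewrite xy.
Qed.

Lemma spanning_tree_complete (p : nat -> nat -> nat) (u v : 'I_n) t :
  prescribed_NSFo_TGR D Gp -> spanning_tree n d adj u (p u) ->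
  D u v = Some t -> p u v != 0.
Proof.
move=> [G [GD /subsetP sub]] [_ closed].
suff h : forall t v, D u v = Some t ->
    exists q, path (usable n d adj u) u q /\ last (u : nat) q = v.
  by move=> /h [q [hq <-]]; apply: closed.
have safeG x y s : [set x; y] \in edges G -> s \in label G [set x; y] ->
    safe_label D s x y by rewrite -GD; apply: NS_Fo_safe.
have Duu : D u u = Some 0 by rewrite -GD mxE eqxx.
move=> {}t; have [m] := ubnP t; elim: m t => // m IHm t tm {}v Duv.
have : by_time (NS_Fo G u v) t by rewrite GD Duv /=.
move=> /by_time_NS_Fo [w [hw lw aw]].
elim/last_ind: w v hw lw aw Duv => [|w [y s] IHw] v hw lw aw Duv.
  by exists [::]; split=> //=; rewrite -lw.
have walk : ns_walk G u v s.
  by exists (rcons w (y, s)); split=> //; rewrite /arrival /unzip2 map_rcons last_rcons.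
move: hw lw aw; rewrite rcons_path last_unzip => /andP [hw /and3P [/= xy sxy le]].
rewrite /unzip1 /unzip2 !map_rcons /arrival !last_rcons /= => yv st; subst y.
have bv := safe_label_bound safeG Duu walk.
rewrite Duv /= in bv; have ts : t = s by apply/eqP; rewrite eqn_leq bv.
subst s; set x := last u (unzip1 w) in xy sxy.
have : by_time (D u x) t by rewrite (safeG _ _ _ xy sxy) Duv /=.
case Dux : (D u x) => [t'|] //=; rewrite leq_eqVlt => /orP [/eqP t't|lt].
- have [q [hq lq]] : exists q, path (usable n d adj u) u q /\ last (u : nat) q = x.
    by apply: IHw; rewrite -?t't // ?Dux ?t't.
  exists (rcons q v); rewrite rcons_path last_rcons lq hq /=; split=> //.
  by apply/usableP; split; [apply: sub|exists t => //; apply: safeG].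
- have [q [hq lq]] := IHm t' (leq_trans lt tm) _ Dux.
  exists (rcons q v); rewrite rcons_path last_rcons lq hq /=; split=> //.
  by apply/usableP; split; [apply: sub|exists t => //; apply: safeG].
Qed.

End Trees.

(** * The temporal graph given by a list of labelled edges *)

Definition labelled_edge n (e : 'I_n * 'I_n * nat) : {set 'I_n} * nat :=
  ([set e.1.1; e.1.2], e.2).

Section GraphOfList.
Variables (n : nat) (Gp : static_graph n) (l : seq ('I_n * 'I_n * nat)).
Hypothesis l_edges : forall e, e \in l -> (labelled_edge e).1 \in edges Gp.
Hypothesis l_gt0 : forall e, e \in l -> 0 < e.2.

Definition list_edge_set : {set {set 'I_n}} :=
  [set s in [seq (labelled_edge e).1 | e <- l]].

Lemma list_edge_set_card2 s : s \in list_edge_set -> #|s| = 2.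
Proof.
by rewrite inE => /mapP [e /l_edges he ->]; apply: edges_card2 he.
Qed.

Definition list_label (s : {set 'I_n}) : {fset nat} :=
  [fset t in [seq e.2 | e <- l & (labelled_edge e).1 == s]]%fset.

Lemma mem_list_label s t :
  (t \in list_label s) = ((s, t) \in [seq labelled_edge e | e <- l]).
Proof.
rewrite inE /=; apply/mapP/mapP => -[e].
  by rewrite mem_filter => /andP [/eqP <- he] ->; exists e.
by move=> he [-> ->]; exists e => //; rewrite mem_filter eqxx.
Qed.

Definition list_static : static_graph n := StaticGraph list_edge_set_card2.

Lemma list_label_gt0 s t : s \in edges list_static -> t \in list_label s -> 0 < t.
Proof. by rewrite mem_list_label => _ /mapP [e /l_gt0 he [_ ->]]. Qed.

Definition list_graph : temporal_graph n := TemporalGraph list_label_gt0.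

Lemma list_graph_sub : subgraph list_graph Gp.
Proof. by apply/subsetP => s; rewrite inE => /mapP [e /l_edges he ->]. Qed.

Lemma list_graph_label0 s : s \in edges list_graph -> label list_graph s != fset0.
Proof.
rewrite inE => /mapP [e he ->]; apply/fset0Pn; exists e.2.
by rewrite mem_list_label; apply/mapP; exists e.
Qed.

Lemma mem_labels (G : temporal_graph n) s t :
  ((s, t) \in labels G) = (s \in edges G) && (t \in label G s).
Proof.
apply/allpairsPdep/andP => [[s' [t' [hs ht [-> ->]]]]|[hs ht]].
  by rewrite mem_enum in hs.
by exists s, t; rewrite mem_enum.
Qed.

Lemma size_labels (G : temporal_graph n) : size (labels G) = num_labels G.
Proof.
rewrite /labels size_allpairs_dep /num_labels sumnE big_map big_enum /=.
by apply: eq_bigr.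
Qed.

Lemma list_graph_labels :
  uniq [seq labelled_edge e | e <- l] ->
  perm_eq [seq labelled_edge e | e <- l] (labels list_graph).
Proof.
move=> ul; apply: uniq_perm => //.
  apply: allpairs_uniq_dep; first exact: enum_uniq.
    by move=> s _; apply: fset_uniq.
  by move=> [s t] [s' t'] _ _ /= [-> ->].
move=> [s t]; rewrite mem_labels /= mem_list_label.
apply/idP/andP => [h|[//]]; split=> //.
by rewrite inE; case/mapP: h => e he [-> _]; apply/mapP; exists e.
Qed.

End GraphOfList.

Lemma set2_inj n (x y a b : 'I_n) : [set x; y] = [set a; b] ->
  x = a /\ y = b \/ x = b /\ y = a.
Proof.
move=> e; have : x \in [set a; b] by rewrite -e set21.
have : y \in [set a; b] by rewrite -e set22.
have : a \in [set x; y] by rewrite e set21.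
have : b \in [set x; y] by rewrite e set22.
by move=> /set2P [] -> /set2P [] -> /set2P [] ? /set2P [] ?; subst; auto.
Qed.

Lemma edge_neq n (G : static_graph n) (x y : 'I_n) :
  [set x; y] \in edges G -> x != y.
Proof. by move=> /edges_card2; rewrite cards2; case: eqP. Qed.

Definition nat_triple n (e : 'I_n * 'I_n * nat) : nat * nat * nat :=
  (val e.1.1, val e.1.2, e.2).

Lemma bounded_triples n (l : seq (nat * nat * nat)) :
  (forall e, e \in l -> e.1.1 < n /\ e.1.2 < n) ->
  exists lo : seq ('I_n * 'I_n * nat), l = map (@nat_triple n) lo.
Proof.
elim: l => [|[[x y] t] l IHl] h; first by exists [::].
have [lo ->] := IHl (fun e he => h e (mem_behead (s := _ :: l) he)).
have [xn yn] := h _ (mem_head _ _).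
by exists ((Ordinal xn, Ordinal yn, t) :: lo).
Qed.

Lemma uniq_map_factor (T A B : eqType) (f : T -> A) (g : T -> B) (s : seq T) :
  {in s &, forall x y, g x = g y -> f x = f y} ->
  uniq (map f s) -> uniq (map g s).
Proof.
elim: s => //= x s IHs h /andP [xs us]; apply/andP; split.
  apply: contra xs => /mapP [y ys gxy].
  by rewrite (h x y) ?map_f ?inE ?eqxx ?ys ?orbT.
by apply: IHs us => y z ys zs; apply: h; rewrite inE ?ys ?zs orbT.
Qed.

Section Correctness.
Variables (n : nat) (D : 'M[option nat]_n) (Gp : static_graph n).
Variables (d adj p : nat -> nat -> nat) (verdict : bool).
Variable l : seq (nat * nat * nat).
Hypothesis D_dist : distance_matrix D.
Hypothesis dE : forall u v : 'I_n, d u v = encode_entry (D u v).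
Hypothesis adjE : forall u v : 'I_n, adj u v = ([set u; v] \in edges Gp).
Hypothesis spec : realize_spec n d adj p verdict l.

Let E := edge_list n adj.

Lemma active_entry (w z : 'I_n) : active E p w z ->
  exists (x : 'I_n) t, [/\ entry d p w z = nat_triple (x, z, t),
    [set x; z] \in edges Gp, D w z = Some t, safe_label D t x z & 0 < t].
Proof.
move=> /andP [pwz xzE]; have [T _ _] := spec.
have := xzE; rewrite mem_edge_list => /and3P [xn _].
rewrite -[_.-1]/(val (Ordinal xn)) adjE eqb0 negbK => xz.
have xNz := edge_neq xz; set x := Ordinal xn in xz xNz *.
have [tree _] := T w (ltn_ord w).
have [[[zw pE]|[x' [pE /andP [_ sf]]]] _] := tree z (ltn_ord z) (lt0n_neq0 pwz).
  by case/negP: xNz; apply/eqP/val_inj; rewrite /= pE zw.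
move: sf; rewrite dE; case Dwz: (D w z) => [t|]; last by case/andP.
have -> : x' = x by rewrite /= pE.
move=> /(safeP dE) sf; exists x, t; split=> //.
  by rewrite /entry dE Dwz.
case: t Dwz sf => // /D_dist wz sf; case/negP: xNz.
have := sf w; rewrite (_ : D w z = Some 0); last exact/D_dist.
case Dwx: (D w x) => [[|k]|] //= _.
by move/D_dist: Dwx => <-; rewrite wz.
Qed.

Lemma realize_spec_correct :
  (verdict <-> prescribed_NSFo_TGR D Gp) /\
  (prescribed_NSFo_TGR D Gp -> exists G lo,
    [/\ realizes D Gp G, l = map (@nat_triple n) lo,
        perm_eq (map (@labelled_edge n) lo) (labels G)
      & forall e, e \in edges G -> label G e != fset0]).
Proof.
have [T V [U S C]] := spec.
have [lo loE] : exists lo, l = map (@nat_triple n) lo.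
  apply: bounded_triples => e /S [w [z [wn zn /andP [_ xzE] ->]]].
  by move: xzE; rewrite mem_edge_list => /and3P [].
have loP e : e \in lo -> [/\ [set e.1.1; e.1.2] \in edges Gp,
    safe_label D e.2 e.1.1 e.1.2 & 0 < e.2].
  move=> he; have /S [w [z [wn zn act]]] : nat_triple e \in l by rewrite loE map_f.
  have [x [t [-> xz Dwz sf t0]]] := @active_entry (Ordinal wn) (Ordinal zn) act.
  case: e {he} => [[a b] s] [] /val_inj -> /= bz ->.
  by rewrite (_ : b = Ordinal zn) //; apply/val_inj.
pose G := list_graph (fun e he => let: And3 a _ _ := loP e he in a)
  (fun e he => let: And3 _ _ a := loP e he in a).
have realG : verdict -> realizes D Gp G.
  move=> /V reached; split; last exact: list_graph_sub.
  have safeG x y s : [set x; y] \in edges G -> s \in label G [set x; y] ->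
      safe_label D s x y.
    rewrite mem_list_label => _ /mapP [e /loP [_ sf _] [/set2_inj h ->]] w.
    by case: h => -[-> ->]; rewrite sf.
  apply/matrixP => u v; apply: by_time_inj => t; apply/idP/idP.
    by move=> /by_time_NS_Fo; apply: safe_label_bound safeG _; apply/D_dist.
  case Duv: (D u v) => [k|] //= kt; apply/by_time_NS_Fo.
  have puv : p u v != 0 by apply: reached => //; rewrite dE Duv.
  have [tree _] := T u (ltn_ord u); have [_ [q [hq lq]]] := tree v (ltn_ord v) puv.
  pose f y := (insubd u y, (d u y).-1).
  have Duu : D u u = Some 0 by apply/D_dist.
  have fu : f u = (u, 0) by rewrite /f valKd dE Duu.
  have fv : f v = (v, k) by rewrite /f valKd dE Duv.
  have last_f : last (u, 0) (map f q) = (v, k) by rewrite -fu last_map lq fv.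
  move: (last_f); rewrite last_unzip => -[l1 l2].
  exists (map f q); split=> //; last by rewrite /arrival l2.
  rewrite -fu path_map; apply: sub_path hq => x y /andP [xy /eqP py].
  have [xn yn] := usable_bound xy.
  have /andP [xyE _] := xy.
  have act : active E p u (Ordinal yn) by rewrite /active /= py.
  have [x' [t' [eE x'y Duy sf t'0]]] := @active_entry _ (Ordinal yn) act.
  have ex : x' = Ordinal xn.
    by apply/val_inj; have := congr1 (fun e => e.1.1) eE; rewrite /= py /= => <-.
  have fy : f y = (Ordinal yn, t').
    by rewrite /f -[y]/(val (Ordinal yn)) valKd dE Duy.
  have fx : f x = (Ordinal xn, (d u x).-1) by rewrite /f -[x]/(val (Ordinal xn)) valKd.
  rewrite /relpre /= fx fy /ns_hop /= -ex mem_list_label.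
  have key_in : ([set x'; Ordinal yn], t') \in [seq labelled_edge e | e <- lo].
    have := C u y (ltn_ord u) yn act; rewrite eE loE => /mapP [e].
    move=> /mapP [[[a b] s] he ->] /esym/eqP; rewrite edge_keyE /= => /andP [/eqP st ab].
    apply/mapP; exists (a, b, s) => //; rewrite /labelled_edge /= -st.
    case/orP: ab => /andP [/eqP xa /eqP yb].
      by congr ([set _; _], _); apply/val_inj.
    by rewrite setUC; congr ([set _; _], _); apply/val_inj.
  rewrite key_in andTb /=; apply/andP; split.
    by rewrite inE; case/mapP: key_in => e he [-> _]; apply/mapP; exists e.
  have := sf u; rewrite Duy /= leqnn ex -[x]/(val (Ordinal xn)) dE.
  by case: (D u _) => [k'|] //= ->.
have complete : prescribed_NSFo_TGR D Gp -> verdict.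
  move=> pres; apply/V => u y un yn duy.
  have := dE (Ordinal un) (Ordinal yn); rewrite /=; case Duy: (D _ _) => [t|] //= dd.
    exact: (spanning_tree_complete dE adjE pres (T _ (ltn_ord (Ordinal un))) Duy).
  by rewrite dd in duy.
split; first by split=> [/realG|/complete //]; exists G.
move=> /complete /realG h; exists G, lo; split=> //.
- apply: list_graph_labels.
  apply: uniq_map_factor (_ : uniq (map (edge_key \o @nat_triple n) lo)).
    move=> [[a b] s] [[a' b'] s'] _ _ [/set2_inj h1 ->] /=.
    by case: h1 => -[-> ->] //; rewrite /edge_key /= minnC maxnC.
  by rewrite map_comp -loE.
- exact: list_graph_label0.
Qed.

End Correctness.

(** * Input, output and resource bounds *)

Lemma nth_allpairs (S T U : Type) (f : S -> T -> U) x0 y0 z0 s t i j :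
  i < size s -> j < size t ->
  nth z0 [seq f x y | x <- s, y <- t] (i * size t + j) = f (nth x0 s i) (nth y0 t j).
Proof.
elim: s i => [|x s IHs] [|i] //= hi hj; rewrite nth_cat size_map.
  by rewrite hj (nth_map y0).
by rewrite mulSn -addnA ltnNge leq_addr /= addKn IHs.
Qed.

Lemma nth_encode_D n (D : 'M[option nat]_n) Gp (u v : 'I_n) :
  nth 0 (encode_input D Gp) (u * n + v) = encode_entry (D u v).
Proof.
rewrite /encode_input nth_cat size_allpairs size_enum_ord.
rewrite index_bound //; have := @nth_allpairs _ _ _ (fun u v => encode_entry (D u v))
  u v 0 (enum 'I_n) (enum 'I_n) u v.
by rewrite !size_enum_ord !nth_ord_enum => ->.
Qed.

Lemma nth_encode_adj n (D : 'M[option nat]_n) Gp (u v : 'I_n) :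
  nth 0 (encode_input D Gp) (n * n + (u * n + v)) = ([set u; v] \in edges Gp).
Proof.
rewrite /encode_input nth_cat size_allpairs size_enum_ord ltnNge leq_addr addKn.
have := @nth_allpairs _ _ _ (fun u v => [set u; v] \in edges Gp : nat)
  u v 0 (enum 'I_n) (enum 'I_n) u v.
by rewrite !size_enum_ord !nth_ord_enum => ->.
Qed.

Lemma nth_encode_default n (D : 'M[option nat]_n) Gp k :
  2 * (n * n) <= k -> nth 0 (encode_input D Gp) k = 0.
Proof.
move=> hk; apply: nth_default; rewrite size_cat !size_allpairs size_enum_ord.
by lia.
Qed.

Lemma size_edge_list n (Gp : static_graph n) (adj : nat -> nat -> nat) :
  (forall u v : 'I_n, adj u v = ([set u; v] \in edges Gp)) ->
  size (edge_list n adj) <= 2 * #|edges Gp|.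
Proof.
move=> adjE; pose l := [seq (e, 0) | e <- edge_list n adj].
have [lo loE] : exists lo, l = map (@nat_triple n) lo.
  apply: bounded_triples => e /mapP [[x y] + ->].
  by rewrite mem_edge_list => /and3P [].
have lo_edges e : e \in lo -> [set e.1.1; e.1.2] \in edges Gp.
  move=> he; have : nat_triple e \in l by rewrite loE map_f.
  case/mapP => -[x y] + [ex ey _]; rewrite mem_edge_list -ex -ey => /and3P [_ _].
  by rewrite adjE eqb0 negbK.
have ul : uniq l.
  rewrite map_inj_uniq; last by move=> ? ? [].
  by rewrite filter_uniq // allpairs_uniq ?iota_uniq // => -[? ?] [? ?] _ _ [-> ->].
pose g (e : 'I_n * 'I_n * nat) := ([set e.1.1; e.1.2], e.1.1 < e.1.2).
have ug : uniq (map g lo).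
  apply: uniq_map_factor (_ : uniq (map (@nat_triple n) lo)); last by rewrite -loE.
  have lo0 e : e \in lo -> e.2 = 0.
    move=> he; have : nat_triple e \in l by rewrite loE map_f.
    by case/mapP => ? _ [].
  move=> [[a b] s] [[a' b'] s'] he he' [/set2_inj [] [-> ->]] lt.
    by move: (lo0 _ he) (lo0 _ he') => /= -> ->.
  have /edge_neq := lo_edges _ he'; rewrite -(inj_eq val_inj) /=.
  by move: lt; case: ltngtP.
have <- : size (map g lo) = size (edge_list n adj).
  by rewrite size_map -(size_map (@nat_triple n)) -loE size_map.
have <- : size [seq (s, b) | s <- enum (edges Gp), b <- [:: true; false]]
    = 2 * #|edges Gp| by rewrite size_allpairs -cardE mulnC.
apply: uniq_leq_size ug _ => _ /mapP [e he ->].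
by apply: allpairs_f; [rewrite mem_enum lo_edges|case: (_ < _)].
Qed.

Lemma acost_mono n K n' K' c : n <= n' -> K <= K' -> acost n K c <= acost n' K' c.
Proof.
move=> hn hK; elim: c => //= [c1 h1 c2 h2|e c h|i b c h]; try lia.
rewrite leq_add2l leq_mul ?leq_add2r //.
by rewrite /loop_bound; case: ifP.
Qed.

Definition realize_prog : cmd :=
  Seq (Assign 4 (Bin Mul (Reg 0) (Reg 0)))
  (Seq (compile realize_cmd)
  (Seq (Assign 0 (Reg 13))
  (Seq (Assign 1 (Reg 14))
       (Assign 2 (Bin Mul (Const 12) (Reg 4)))))).

Lemma acost_bound a b : 0 < a -> 0 < b ->
  acost a (2 * b) realize_cmd + 100 <= 2000 * (a ^ 2 * b).
Proof.
move=> ha hb; rewrite /= /loop_bound /=.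
have h1 : a * 1 <= a * a by rewrite leq_mul2l ha orbT.
have h2 : a * a * 1 <= a * a * b by rewrite leq_mul2l hb orbT.
have h3 : a * b * 1 <= a * b * a by rewrite leq_mul2l ha orbT.
have h4 : b * 1 <= b * a by rewrite leq_mul2l ha orbT.
rewrite expnS expn1; lia.
Qed.

Lemma mkseq_triples (f : nat -> nat) c :
  mkseq f (3 * c) =
  flatten [seq [:: e.1.1; e.1.2; e.2] |
    e <- mkseq (fun i => (f (3 * i + 0), f (3 * i + 1), f (3 * i + 2))) c].
Proof.
elim: c => // c IHc; rewrite mkseqS map_rcons flatten_rcons -IHc.
have -> : 3 * c.+1 = (3 * c).+3 by lia.
by rewrite !mkseqS -!cats1 -!catA /= addn0 addn1 addn2.
Qed.

Lemma word_bound_big n K (D : 'M[option nat]_n) : K <= n * n ->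
  15 * (n * n) + K + n + 16 < word_bound 2000 D.
Proof.
move=> hK; rewrite /word_bound; set w := n + max_entry D + 2.
have w2 : 2 <= w by rewrite /w; lia.
have nw : n <= w by rewrite /w; lia.
apply: (@leq_trans (w ^ 7)); last by rewrite leq_pexp2l //; lia.
have h2 : 2 * 2 <= w * w by apply: leq_mul.
have h4 : (2 * 2) * (2 * 2) <= (w * w) * (w * w) by apply: leq_mul.
have h5 : 2 * ((2 * 2) * (2 * 2)) <= w * ((w * w) * (w * w)) by apply: leq_mul.
have hn : n * n <= w * w by apply: leq_mul.
have h7 : (w * w) * (2 * ((2 * 2) * (2 * 2))) <= (w * w) * (w * ((w * w) * (w * w))).
  by apply: leq_mul.
rewrite !expnS expn0 muln1 !mulnA in h7 *; apply: leq_trans h7.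
have h1 : w * 2 <= w * w by rewrite leq_mul2l w2 orbT.
lia.
Qed.

Lemma entry_lt_word_bound n (D : 'M[option nat]_n) u v :
  encode_entry (D u v) + 1 < word_bound 2000 D.
Proof.
rewrite /word_bound; set w := n + max_entry D + 2.
have w2 : 2 <= w by rewrite /w; lia.
have n0 : 0 < n by case: (u) => i; apply: leq_ltn_trans.
apply: (@leq_trans (w ^ 1)); last by rewrite leq_pexp2l //; lia.
have : odflt 0 (D u v) <= max_entry D.
  by apply: leq_trans (leq_bigmax (F := fun u => _) u); apply: (leq_bigmax v).
by rewrite expn1 /w; case: (D u v) => [k|] /=; lia.
Qed.

Lemma realize_prog_run n (D : 'M[option nat]_n) Gp (d adj : nat -> nat -> nat) :
  (forall u v, d u v = nth 0 (encode_input D Gp) (u * n + v)) ->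
  (forall u v, adj u v = nth 0 (encode_input D Gp) (n * n + (u * n + v))) ->
  exists t m p l, [/\
    exec (space_bound 2000 n) (word_bound 2000 D) realize_prog
      (initial_state D Gp) t m,
    t <= time_bound 2000 n #|edges Gp|,
    realize_spec n d adj p (reg m 0 != 0) l,
    reg m 1 = size l /\ size l <= n * n &
    reg m 2 + 3 * reg m 1 <= space_bound 2000 n /\
    mkseq (fun i => Defs.mem m (reg m 2 + i)) (3 * reg m 1) =
      flatten [seq [:: e.1.1; e.1.2; e.2] | e <- l]].
Proof.
move=> dE adjE; set space := space_bound _ _; set W := word_bound _ _.
have dO (u v : 'I_n) : d u v = encode_entry (D u v) by rewrite dE nth_encode_D.
have aO (u v : 'I_n) : adj u v = ([set u; v] \in edges Gp).
  by rewrite adjE nth_encode_adj.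
pose K := size (edge_list n adj).
have K_edges : K <= 2 * #|edges Gp| by apply: size_edge_list.
have K_small : K <= n * n by apply: size_edges_upto.
have W_big : 15 * (n * n) + K + n + 16 < W by apply: word_bound_big.
have space_big : 15 * (n * n) <= space.
  by rewrite /space /space_bound leq_mul // mulnn leq_exp2r // leq_maxr.
pose mem0 := nth 0 (encode_input D Gp).
pose reg1 := update (update (fun _ => 0) 0 n) 4 (n * n).
pose s1 := AState reg1 (fun i k => mem0 ((3 + 3 * i) * (n * n) + k))
  (fun i x y => mem0 (i * (n * n) + (x * n + y))).
have rep1 : represents n (State reg1 mem0) s1 by split.
have d1 : mt s1 0 = d by apply/funext => u; apply/funext => v; rewrite dE.
have a1 : mt s1 1 = adj.
  by apply/funext => u; apply/funext => v; rewrite adjE /= mul1n.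
have exec1 : exec space W (Assign 4 (Bin Mul (Reg 0) (Reg 0)))
    (initial_state D Gp) 4 (State reg1 mem0).
  apply: (@exec_Assign _ _ (initial_state D Gp) 4 (Bin Mul (Reg 0) (Reg 0))).
  by rewrite /= /update /= /fit ifT //; lia.
have [||||||t [m [s [exec2 cost2 rep2 _]]]] :=
  @realize_run n K space W space_big W_big K_small s1 _ _ _ _ _ _ _ rep1.
- by rewrite a1.
- by [].
- by [].
- move=> u v un vn; rewrite d1.
  by rewrite (dO (Ordinal un) (Ordinal vn)) entry_lt_word_bound.
- move=> u v un vn; apply: nth_encode_default.
  by rewrite leq_addr.
- move=> u un; rewrite a1 (aO (Ordinal un) (Ordinal un)) setUid.
  by apply/eqP; rewrite eqb0; apply/negP => /edges_card2; rewrite cards1.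
rewrite d1 a1 => -[p [spec count]].
have [rE r0 r4 _ vecE] := rep2.
pose reg3 := update (update (update (reg m) 0 (rg s 13)) 1 (rg s 14)) 2 (12 * (n * n)).
exists (4 + (t + (2 + (2 + 4)))), (State reg3 (Defs.mem m)), p, (read_triples s).
split.
- apply: exec_Seq exec1 _; apply: exec_Seq exec2 _.
  apply: (exec_Seq (s2 := State (update (reg m) 0 (rg s 13)) (Defs.mem m))).
    by apply: (@exec_Assign _ _ m 0 (Reg 13)); rewrite /= rE.
  pose reg2 := update (update (reg m) 0 (rg s 13)) 1 (rg s 14).
  apply: (exec_Seq (s2 := State reg2 (Defs.mem m))).
    apply: (@exec_Assign _ _ (State _ _) 1 (Reg 14)).
    by rewrite /= /update /= rE.
  apply: (@exec_Assign _ _ (State _ _) 2 (Bin Mul (Const 12) (Reg 4))).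
  rewrite /= /reg2 /update /= rE r4 /fit ifT /=; last by lia.
  by rewrite ifT //; lia.
- have ha : 0 < maxn 1 n by rewrite leq_maxl.
  have hb : 0 < maxn 1 #|edges Gp| by rewrite leq_maxl.
  apply: leq_trans (acost_bound ha hb).
  apply: (@leq_trans (acost n K realize_cmd + 100)); first by lia.
  rewrite leq_add2r acost_mono ?leq_maxr //.
  by apply: leq_trans K_edges _; rewrite leq_mul2l leq_maxr.
- exact: spec.
- by rewrite size_mkseq.
- rewrite /= /reg3 /update /=; split; first by lia.
  rewrite -mkseq_triples; apply/eq_in_map => i; rewrite mem_iota add0n => hi.
  by rewrite -(vecE 3) //; lia.
Qed.

Theorem theorem3p15 :
  exists (prog : cmd) (c : nat),
    forall (n : nat) (D : 'M[option nat]_n) (Gp : static_graph n),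
      distance_matrix D ->
      runs_within prog c D Gp (fun s =>
        (accepts s <-> prescribed_NSFo_TGR D Gp) /\
        (prescribed_NSFo_TGR D Gp ->
           exists G : temporal_graph n,
             [/\ realizes D Gp G, num_labels G <= n ^ 2
               & outputs (space_bound c n) s G])).
Proof.
exists realize_prog, 2000 => n D Gp D_dist.
pose d u v := nth 0 (encode_input D Gp) (u * n + v).
pose adj u v := nth 0 (encode_input D Gp) (n * n + (u * n + v)).
have [t [m [p [l [run cost spec [r1 sz] [sp out]]]]]] :=
  @realize_prog_run n D Gp d adj (fun _ _ => erefl) (fun _ _ => erefl).
have dO (u v : 'I_n) : d u v = encode_entry (D u v) by exact: nth_encode_D.
have aO (u v : 'I_n) : adj u v = ([set u; v] \in edges Gp) by exact: nth_encode_adj.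
have [acc real] := realize_spec_correct D_dist dO aO spec.
exists t, m; split=> //; split=> // /real [G [lo [GD lE labE lab0]]].
exists G; split=> //.
  rewrite -size_labels -(perm_size labE) size_map -(size_map (@nat_triple n)) -lE.
  by rewrite expnS expn1.
split=> //; split=> //; exists lo; split=> //.
by rewrite out lE -map_comp.
Qed.
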